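(* For a rectangular box $\Omega\subset\mathbb{R}^n$ and $c\in(0,\mu_2)$, let $u_c$ be the solution of $$-\Delta u=cu \ \text{ in } \Omega,\qquad \frac{\partial u}{\partial\nu}=-1\ \text{ on }\partial\Omega ,$$ where $\mu_2=\mu_2(\Omega)$. Then for every rectangular box $\Omega\subset\mathbb{R}^n$, $$\lim_{c\to\mu_2^-}c\int_{\partial\Omega}u_c\,d\sigma\ \ge\ \frac{n-1}{n}\,\frac{P^2(\Omega)}{|\Omega|}.$$ Equality in this inequality is achieved only when $\Omega$ is a cube in $\mathbb{R}^n$.
   Context: A rectangular box in $\mathbb{R}^n$ is a Cartesian product of $n$ bounded open intervals. $0=\mu_1<\mu_2\le\cdots$ are the Neumann Laplacian eigenvalues of $\Omega$ counted with multiplicity. For $c\in(0,\mu_2)$ the problem has a unique weak solution in $H^1(\Omega)$, i.e. a unique $u\in H^1(\Omega)$ with $\int_\Omega\nabla u\cdot\nabla\varphi\,dx+\int_{\partial\Omega}\varphi\,d\sigma=c\int_\Omega u\varphi\,dx$ for all $\varphi\in H^1(\Omega)$. $\nu$ is the outer unit normal, $d\sigma$ surface measure, $P(\Omega)$ the perimeter and $|\Omega|$ the volume of $\Omega$. *)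

(* Defs.v *)
From HB Require Import structures.
From mathcomp Require Import all_boot all_order all_algebra.
From mathcomp Require Import all_classical all_reals all_analysis.

Set Implicit Arguments.
Unset Strict Implicit.
Unset Printing Implicit Defensive.
Import Order.TTheory GRing.Theory Num.Theory.
Import numFieldNormedType.Exports.
Local Open Scope classical_set_scope.
Local Open Scope ring_scope.

(* The points of R^n are the row vectors 'rV[R]_n, with the sigma-algebra     *)
(* generated by the coordinate functions (the Borel sigma-algebra).           *)

Definition measure_rV_display : measure_display -> measure_display.
Proof. exact. Qed.

Section measurable_rV.
Context {R : realType} (n : nat).

Definition coord_rV (i : 'I_n) (x : 'rV[R]_n) : R := x ord0 i.

Let rV_set0 : g_sigma_preimage coord_rV set0.
Proof. exact: sigma_algebra0. Qed.

Let rV_setC A : g_sigma_preimage coord_rV A -> g_sigma_preimage coord_rV (~` A).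
Proof. exact: sigma_algebraC. Qed.

Let rV_bigcup (F : _^nat) : (forall i, g_sigma_preimage coord_rV (F i)) ->
  g_sigma_preimage coord_rV (\bigcup_i (F i)).
Proof. exact: sigma_algebra_bigcup. Qed.

HB.instance Definition _ :=
  @isMeasurable.Build (measure_rV_display (R.-ocitv.-measurable.-sigma)%mdisp)
    'rV[R]_n (g_sigma_preimage coord_rV) rV_set0 rV_setC rV_bigcup.

Lemma measurable_coord_rV i : measurable_fun [set: 'rV[R]_n] (coord_rV i).
Proof.
move=> _ Y mY; rewrite setTI; apply: sub_sigma_algebra => /=.
rewrite -bigcup_seq/=; exists i => /=; first by rewrite mem_index_enum.
by exists Y => //; rewrite setTI.
Qed.

Lemma measurable_fun_rVP d (T : measurableType d) (f : T -> 'rV[R]_n) :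
  measurable_fun [set: T] f <->
  forall i, measurable_fun [set: T] (fun x => f x ord0 i).
Proof.
split=> [mf i|mf].
  exact: (measurableT_comp (measurable_coord_rV i) mf).
suff prefS : g_sigma_preimage (fun i => coord_rV i \o f) `<=` measurable.
  move: prefS; rewrite g_sigma_preimage_comp => prefS _ A mA.
  by rewrite setTI; apply: prefS; exists A => //; rewrite setTI.
apply: smallest_sub; first exact: sigma_algebra_measurable.
move=> A; rewrite -bigcup_seq/= => -[i _ [B mB <-]].
exact: (mf i).
Qed.

End measurable_rV.

(* insert i s y is the point of R^n whose i-th coordinate is s and whose      *)
(* other coordinates are, in order, those of y.                               *)
Definition insert {R : realType} {n : nat} (i : 'I_n) (s : R)
    (y : 'rV[R]_n.-1) : 'rV[R]_n :=
  \row_j if unlift i j is Some k then y ord0 k else s.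

Lemma measurable_insert {R : realType} d (T : measurableType d) {n : nat}
    (i : 'I_n) (s : T -> R) (y : T -> 'rV[R]_n.-1) :
  measurable_fun [set: T] s -> measurable_fun [set: T] y ->
  measurable_fun [set: T] (fun t => insert i (s t) (y t)).
Proof.
move=> ms my; apply/measurable_fun_rVP => j.
under eq_fun do rewrite mxE.
by case: (unlift i j) => [k|//]; exact: (measurable_fun_rVP _).1 my k.
Qed.

(* Lebesgue measure on R^n, by recursion on n: the image of the product of    *)
(* the Lebesgue measures on R and on R^n under (s, y) |-> insert ord0 s y.    *)
Section lebesgue_rVS.
Context {R : realType} (n : nat).
Variable mu : {sigma_finite_measure set 'rV[R]_n -> \bar R}.
Local Open Scope ereal_scope.

Definition cons_rV (p : measurableTypeR R * 'rV[R]_n) : 'rV[R]_n.+1 :=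
  @insert R n.+1 ord0 p.1 p.2.

Lemma measurable_cons_rV : measurable_fun [set: _] cons_rV.
Proof. exact: (@measurable_insert R _ _ n.+1). Qed.

Definition lebesgue_rVS : set 'rV[R]_n.+1 -> \bar R :=
  pushforward (@lebesgue_measure R \x mu) cons_rV.

Let lebesgue_rVS0 : lebesgue_rVS set0 = 0.
Proof. by rewrite /lebesgue_rVS /pushforward preimage_set0 measure0. Qed.

Let lebesgue_rVS_ge0 A : 0 <= lebesgue_rVS A.
Proof. by rewrite /lebesgue_rVS /pushforward measure_ge0. Qed.

Let mpre (A : set 'rV[R]_n.+1) : measurable A -> measurable (cons_rV @^-1` A).
Proof.
by move=> mA; rewrite -[X in measurable X]setTI; exact: measurable_cons_rV.
Qed.

Let lebesgue_rVS_sigma_additive : semi_sigma_additive lebesgue_rVS.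
Proof.
move=> F mF tF mUF; rewrite /lebesgue_rVS /pushforward preimage_bigcup.
apply: measure_semi_sigma_additive.
- by move=> k; exact: mpre.
- apply/trivIsetP => /= i j _ _ ij; rewrite -preimage_setI.
  by move/trivIsetP : tF => /(_ _ _ _ _ ij) ->//; rewrite preimage_set0.
- by rewrite -preimage_bigcup; exact: mpre.
Qed.

HB.instance Definition _ := isMeasure.Build _ _ _ lebesgue_rVS
  lebesgue_rVS0 lebesgue_rVS_ge0 lebesgue_rVS_sigma_additive.

Let uncons_rV (x : 'rV[R]_n.+1) : measurableTypeR R * 'rV[R]_n :=
  (x ord0 ord0, \row_j x ord0 (lift ord0 j)).

Let cons_rVK : cancel cons_rV uncons_rV.
Proof.
move=> [s y]; congr pair; first by rewrite mxE unlift_none.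
by apply/rowP => j; rewrite !mxE liftK.
Qed.

Let measurable_uncons_rV : measurable_fun [set: _] uncons_rV.
Proof.
apply/measurable_fun_pairP; split.
  exact: (measurable_coord_rV ord0).
apply/measurable_fun_rVP => j.
under eq_fun do rewrite mxE.
exact: (measurable_coord_rV (lift ord0 j)).
Qed.

Let lebesgue_rVS_sigma_finite : sigma_finite setT lebesgue_rVS.
Proof.
have /sigma_finiteP[F [TF ndF Foo]] := sigma_finiteT (@lebesgue_measure R).
have /sigma_finiteP[G [TG ndG Goo]] := sigma_finiteT mu.
exists (fun k => uncons_rV @^-1` (F k `*` G k)).
  apply/seteqP; split => // x _.
  have [i _ Fi] : (\bigcup_k F k) (uncons_rV x).1 by rewrite -TF.
  have [j _ Gj] : (\bigcup_k G k) (uncons_rV x).2 by rewrite -TG.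
  exists (maxn i j) => //; split.
    by apply: (subsetPset _ _ _) Fi; apply: ndF; exact: leq_maxl.
  by apply: (subsetPset _ _ _) Gj; apply: ndG; exact: leq_maxr.
move=> k; have [mF Fk] := Foo k; have [mG Gk] := Goo k; split.
  rewrite -[X in measurable X]setTI; apply: measurable_uncons_rV => //.
  exact: measurableX.
rewrite /lebesgue_rVS /pushforward -comp_preimage.
rewrite (_ : uncons_rV \o cons_rV = id); last first.
  by apply/funext => p; exact: cons_rVK.
by rewrite preimage_id product_measure1E// lte_mul_pinfty// ge0_fin_numE.
Qed.

HB.instance Definition _ := Measure_isSigmaFinite.Build _ _ _ lebesgue_rVS
  lebesgue_rVS_sigma_finite.

End lebesgue_rVS.

Fixpoint lebesgue_rV {R : realType} (n : nat) :
    {sigma_finite_measure set 'rV[R]_n -> \bar R} :=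
  match n with
  | 0%N => \d_(0 : 'rV[R]_0)
  | n.+1 => lebesgue_rVS (lebesgue_rV n)
  end.

Section box.
Context {R : realType} {n : nat}.
Implicit Types a b : 'rV[R]_n.

Definition box a b : set 'rV[R]_n :=
  [set x | forall i, a ord0 i < x ord0 i < b ord0 i].

Lemma measurable_box a b : measurable (box a b).
Proof.
rewrite (_ : box a b =
    \bigcap_(i in [set: 'I_n]) (coord_rV i @^-1` `]a ord0 i, b ord0 i[)).
  apply: fin_bigcap_measurable => // i _.
  rewrite -[X in measurable X]setTI.
  by apply: measurable_coord_rV => //; exact: measurable_itv.
by apply/seteqP; split=> x abx i => [_|]; have := abx i;
  rewrite /= in_itv//= => /(_ I).
Qed.

Definition volume a b : R := fine (lebesgue_rV n (box a b)).

End box.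

Lemma lebesgue_rV_box {R : realType} n (a b : 'rV[R]_n) :
  (forall i, a ord0 i <= b ord0 i) ->
  lebesgue_rV n (box a b) = (\prod_(i < n) (b ord0 i - a ord0 i))%:E.
Proof.
elim: n a b => [|n IHn] a b ab.
  rewrite big_ord0 /= diracE mem_set//; first by move=> -[].
rewrite big_ord_recl /= /lebesgue_rVS /pushforward.
rewrite (_ : _ @^-1` _ =
    `]a ord0 ord0, b ord0 ord0[ `*` box (col' ord0 a) (col' ord0 b)).
  rewrite product_measure1E ?measurable_itv//; last exact: measurable_box.
  rewrite IHn => [|i]; last by rewrite !mxE.
  transitivity ((b ord0 ord0 - a ord0 ord0)%:E *
      (\prod_(i < n) (col' ord0 b ord0 i - col' ord0 a ord0 i))%:E)%E.
    congr (_ * _)%E.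
    apply: etrans (lebesgue_measure_itv _) _.
    rewrite /= lte_fin; case: ltP => // ba.
    by have := ab ord0; rewrite le_eqVlt ltNge ba orbF => /eqP ->; rewrite subrr.
  by rewrite -EFinM; congr (_ * _)%:E; apply: eq_bigr => i _; rewrite !mxE.
apply/seteqP; split=> [[s y]/= xab|[s y]/= [sab yab] i].
  split; first by have := xab ord0; rewrite mxE unlift_none/= in_itv.
  by move=> i; have := xab (lift ord0 i); rewrite !mxE liftK.
have [j ->|->] := unliftP ord0 i.
  by have := yab j; rewrite !mxE liftK.
by rewrite mxE unlift_none; move: sab; rewrite in_itv.
Qed.

(* The surface measure of the boundary of box a b: the sum, over the 2n       *)
(* faces {x_i = a_i} and {x_i = b_i}, of the (n-1)-dimensional Lebesgue       *)
(* measure. The faces are taken relatively open: the edges are null sets.     *)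
(* For n = 1 it is the counting measure on the two endpoints.                 *)
Section surface.
Context {R : realType} {n : nat} (a b : 'rV[R]_n).
Local Open Scope ereal_scope.

Definition surface (A : set 'rV[R]_n) : \bar R :=
  \sum_(i < n) \sum_(s <- [:: a ord0 i; b ord0 i])
    lebesgue_rV n.-1 (box (col' i a) (col' i b) `&` insert i s @^-1` A).

Let surface0 : surface set0 = 0.
Proof.
by apply: big1 => i _; apply: big1 => s _; rewrite preimage_set0 setI0 measure0.
Qed.

Let surface_ge0 A : 0 <= surface A.
Proof. by apply: sume_ge0 => i _; apply: sume_ge0 => s _; exact: measure_ge0. Qed.

Let mpre i s (A : set 'rV[R]_n) : measurable A ->
  measurable (box (col' i a) (col' i b) `&` insert i s @^-1` A).
Proof.
move=> mA; apply: measurableI; first exact: measurable_box.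
rewrite -[X in measurable X]setTI.
exact: (measurable_insert i (measurable_cst s) (@measurable_id _ _ _)).
Qed.

Let surface_sigma_additive : semi_sigma_additive surface.
Proof.
move=> F mF tF mUF.
rewrite (_ : (fun _ => _) = fun k => \sum_(i < n)
    \sum_(s <- [:: a ord0 i; b ord0 i]) \sum_(0 <= j < k)
    lebesgue_rV n.-1 (box (col' i a) (col' i b) `&` insert i s @^-1` F j)).
  apply: cvg_nnesum => i _.
    by near=> k; do 2!(apply: sume_ge0 => ? _); exact: measure_ge0.
  apply: cvg_nnesum => s _.
    by near=> k; apply: sume_ge0 => ? _; exact: measure_ge0.
  rewrite preimage_bigcup setI_bigcupr.
  apply: measure_semi_sigma_additive.
  - by move=> k; exact: mpre.
  - apply/trivIsetP => /= j k _ _ jk; rewrite setIACA setIid -preimage_setI.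
    by move/trivIsetP : tF => /(_ _ _ _ _ jk) ->//; rewrite preimage_set0 setI0.
  - by rewrite -setI_bigcupr -preimage_bigcup; exact: mpre.
apply/funext => k; rewrite /surface exchange_big/=; apply: eq_bigr => i _.
by rewrite exchange_big.
Unshelve. all: by end_near. Qed.

HB.instance Definition _ := isMeasure.Build _ _ _ surface
  surface0 surface_ge0 surface_sigma_additive.

Definition perimeter : R := fine (surface [set: 'rV[R]_n]).

End surface.

Section sobolev.
Context {R : realType} {n : nat}.
Local Notation Rn := 'rV[R]_n.
Local Notation leb := (lebesgue_rV n).
Implicit Types (Omega : set Rn) (u v phi : Rn -> R) (g h : 'I_n -> Rn -> R).

Definition partial (i : 'I_n) phi : Rn -> R :=
  fun x => 'D_(delta_mx ord0 i) phi x.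

Fixpoint differentiable_upto (k : nat) phi : Prop :=
  match k with
  | 0%N => continuous phi
  | k.+1 => continuous phi /\ forall i : 'I_n,
      (forall x, derivable phi x (delta_mx ord0 i)) /\
      differentiable_upto k (partial i phi)
  end.

Definition smooth phi : Prop := forall k, differentiable_upto k phi.

Definition test_function Omega phi : Prop :=
  smooth phi /\
  exists K, [/\ compact K, K `<=` Omega & forall x, ~ K x -> phi x = 0].

Definition square_integrable d (T : measurableType d)
    (mu : {measure set T -> \bar R}) (D : set T) (f : T -> R) : Prop :=
  measurable_fun D f /\ mu.-integrable D (fun x => (f x ^+ 2)%:E).

(* u is in H^1(Omega) and g is its weak gradient *)
Definition H1 Omega u g : Prop :=
  [/\ square_integrable leb Omega u,
      forall i, square_integrable leb Omega (g i) &
      forall phi i, test_function Omega phi ->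
        \int[leb]_(x in Omega) (u x * partial i phi x) =
        - \int[leb]_(x in Omega) (g i x * phi x)].

(* The trace of u on the boundary of the box, u being in H^1 with weak        *)
(* gradient g: the limit in L^2(boundary) of the restrictions of functions    *)
(* smooth up to the boundary that converge to u in H^1.                       *)
Definition is_trace (a b : Rn) u g (t : Rn -> R) : Prop :=
  square_integrable (surface a b) setT t /\
  exists phi : nat -> Rn -> R,
    [/\ forall k, smooth (phi k),
        (\int[leb]_(x in box a b) ((phi k x - u x) ^+ 2)) @[k --> \oo] --> 0,
        forall i, (\int[leb]_(x in box a b) ((partial i (phi k) x - g i x) ^+ 2))
          @[k --> \oo] --> 0 &
        (\int[surface a b]_x ((phi k x - t x) ^+ 2)) @[k --> \oo] --> 0].

Definition dot_integral Omega g h : R :=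
  \int[leb]_(x in Omega) (\sum_i g i x * h i x).

Definition weak_solution (a b : Rn) (c : R) u : Prop :=
  exists2 g, H1 (box a b) u g &
  forall phi h t, H1 (box a b) phi h -> is_trace a b phi h t ->
    dot_integral (box a b) g h + \int[surface a b]_x t x =
    c * \int[leb]_(x in box a b) (u x * phi x).

(* t is the boundary value of u in H^1 *)
Definition boundary_value (a b : Rn) u (t : Rn -> R) : Prop :=
  exists2 g, H1 (box a b) u g & is_trace a b u g t.

Definition ae_eq_in Omega u v : Prop :=
  {ae leb, forall x, Omega x -> u x = v x}.

Definition neumann_eigenfunction Omega (lambda : R) u : Prop :=
  ~ ae_eq_in Omega u (cst 0) /\
  exists2 g, H1 Omega u g &
  forall phi h, H1 Omega phi h ->
    dot_integral Omega g h =
    lambda * \int[leb]_(x in Omega) (u x * phi x).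

(* mu 0 <= mu 1 <= ... lists the Neumann eigenvalues of Omega, each repeated  *)
(* according to its multiplicity: there are independent eigenfunctions e k of *)
(* eigenvalues mu k such that, for each lambda, those with mu k = lambda form *)
(* a basis of the eigenspace of lambda. Since the indices start from 0, mu 1  *)
(* is the eigenvalue that is usually written mu_2.                            *)
Definition neumann_spectrum Omega (mu : nat -> R) : Prop :=
  (forall k, mu k <= mu k.+1) /\
  exists e : nat -> Rn -> R,
    [/\ forall k, neumann_eigenfunction Omega (mu k) (e k),
        forall N (r : 'I_N -> R),
          ae_eq_in Omega (fun x => \sum_(k < N) r k * e k x) (cst 0) ->
          forall k, r k = 0 &
        forall lambda u, neumann_eigenfunction Omega lambda u ->
          exists N (r : 'I_N -> R),
            (forall k : 'I_N, mu k != lambda -> r k = 0) /\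
            ae_eq_in Omega u (fun x => \sum_(k < N) r k * e k x)].

Definition is_cube (a b : Rn) : Prop :=
  forall i j, b ord0 i - a ord0 i = b ord0 j - a ord0 j.

End sobolev.

(* Main.v *)
Require Import Defs.
From mathcomp Require Import all_boot all_order all_algebra.
From mathcomp Require Import all_classical all_reals all_analysis.
From mathcomp Require Import measurable_realfun ring lra.
Import Order.TTheory GRing.Theory Num.Theory.
Import numFieldNormedType.Exports.
Set Implicit Arguments.
Unset Strict Implicit.
Unset Printing Implicit Defensive.
Local Open Scope classical_set_scope.
Local Open Scope ring_scope.

(* With L_i the sides of the box and k = sqrt c, the solution is explicit,
   w = sum_i cos (k (x_i - m_i)) / (k sin (k L_i / 2)), m the centre of the box.
   Testing the weak equation of u_c against w, and the classical equation of w
   against smooth approximations of u_c, shows that u_c and w have the same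
   boundary integral, so uniqueness is not needed.  That integral is elementary
   and extends continuously to k = pi / Lmax; with x_j = Lmax / L_j >= 1 the
   inequality reduces to x^2 - (pi/2) x cot (pi/(2x)) <= 1, that is, to
   y cot y >= 1 - 4 y^2 / pi^2 on (0, pi/2].
   That mu_2 = (pi / Lmax)^2 comes from the hypothesis on mu as follows: the
   functions cos (pi (x_i - a_i) / L_i) are eigenfunctions; conversely, moving
   the Laplacian onto products of powers of these cosines shows that, up to a
   constant, an eigenfunction of smaller eigenvalue is orthogonal to all
   polynomials in them, hence is constant. *)

(** * Calculus of smooth functions of several variables *)

Section smooth_functions.
Context {R : realType} {n : nat}.
Local Notation Rn := 'rV[R]_n.
Local Notation e_ i := (delta_mx ord0 i : Rn).
Implicit Types (phi psi : Rn -> R) (x : Rn) (f : R -> R).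

(** A weak solution or an eigenfunction is only an H^1 function with some weak gradient: no
    regularity is at hand, and for an eigenfunction no trace. Derivatives must therefore fall on
    explicit smooth functions, while the definition of H^1 admits compactly supported test functions
    only. In the spectral part the normal derivatives of the cosine products vanish linearly on the
    faces, so they can be cut off by functions whose derivative is at most of order 1/distance; the
    flat functions below serve to build these. For the boundary integral the field does not vanish
    on the faces, and the approximations contained in the definition of the trace take over.
    Orthogonality to polynomials in the cosines becomes vanishing through explicit polynomials that
    converge boundedly to indicators of boxes. At [k = pi / Lmax] nothing blows up: the longest side
    contributes cot (pi / 2) = 0. With S the sum of the 1 / L_j, the final inequality combines one
    cotangent estimate per side with S >= n / Lmax, and the latter is an equality only for a
    cube. *)

Lemma is_derive_line (i : 'I_n) phi f x df :
  (forall h, phi (h *: e_ i + x) = f (h + x ord0 i)) ->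
  is_derive (x ord0 i) 1 f df -> is_derive x (e_ i) phi df.
Proof.
move=> phif [fd fE].
have lineE : (fun h => h^-1 *: (phi (h *: e_ i + x) - phi x)) =
    (fun h => h^-1 *: (f (h *: 1 + x ord0 i) - f (x ord0 i))).
  apply/funext => h; rewrite phif; congr (_ *: (f _ - _)).
    by rewrite scaler1.
  by have := phif 0; rewrite scale0r !add0r.
by split; [rewrite /derivable lineE|rewrite /derive lineE].
Qed.

Lemma is_derive_coord (i : 'I_n) f x df :
  is_derive (x ord0 i) 1 f df ->
  is_derive x (e_ i) (fun x => f (x ord0 i)) df.
Proof.
by apply: is_derive_line => h; rewrite !mxE !eqxx/= mulr1.
Qed.

Lemma is_derive_indep (i : 'I_n) phi x :
  (forall h, phi (h *: e_ i + x) = phi x) -> is_derive x (e_ i) phi 0.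
Proof.
by move=> H; apply: (is_derive_line (f := cst (phi x))) => // h; rewrite H.
Qed.

Lemma partial_indep (i : 'I_n) phi :
  (forall h x, phi (h *: e_ i + x) = phi x) -> partial i phi = cst 0.
Proof.
by move=> H; apply/funext => x; have [] := @is_derive_indep i phi x (H^~ x).
Qed.

(** The product rule leaves one factor undifferentiated, so the induction in [differentiable_uptoM]
    needs that factor at the lower order. *)
Lemma differentiable_uptoW k phi :
  differentiable_upto k.+1 phi -> differentiable_upto k phi.
Proof.
elim: k phi => [phi []//|k IH phi [cphi H]]; split => // i.
by have [d D] := H i; split => //; exact: IH.
Qed.

Lemma differentiable_upto_cst k (r : R) :
  differentiable_upto k (cst r : Rn -> R).
Proof.
elim: k r => [r|k IH r] /=; first exact: cst_continuous.
split; first exact: cst_continuous.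
move=> i; split => // ; rewrite partial_indep//.
Qed.

Lemma differentiable_uptoD k phi psi : differentiable_upto k phi ->
  differentiable_upto k psi -> differentiable_upto k (phi \+ psi).
Proof.
elim: k phi psi => [f g cf cg x|k IH f g [cf Hf] [cg Hg]] /=.
  exact: continuousD (cf x) (cg x).
split; first by move=> x; exact: continuousD (cf x) (cg x).
move=> i; have [df pf] := Hf i; have [dg pg] := Hg i; split.
  by move=> x; exact: derivableD.
rewrite (_ : partial i _ = partial i f \+ partial i g); first exact: IH.
by apply/funext => x; exact: deriveD.
Qed.

Lemma differentiable_uptoM k phi psi : differentiable_upto k phi ->
  differentiable_upto k psi -> differentiable_upto k (phi \* psi).
Proof.
elim: k phi psi => [f g cf cg x|k IH f g Hf Hg] /=.
  exact: continuousM (cf x) (cg x).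
have fk := differentiable_uptoW Hf; have gk := differentiable_uptoW Hg.
case: Hf Hg => [cf Hf] [cg Hg].
split; first by move=> x; exact: continuousM (cf x) (cg x).
move=> i; have [df pf] := Hf i; have [dg pg] := Hg i; split.
  by move=> x; exact: derivableM.
rewrite (_ : partial i _ = (f \* partial i g) \+ (g \* partial i f)).
  by apply: differentiable_uptoD; exact: IH.
by apply/funext => x; exact: deriveM.
Qed.

Lemma smooth_cst (r : R) : smooth (cst r : Rn -> R).
Proof. by move=> k; exact: differentiable_upto_cst. Qed.

Lemma smoothD phi psi : smooth phi -> smooth psi -> smooth (phi \+ psi).
Proof. by move=> F G k; exact: differentiable_uptoD. Qed.

Lemma smoothM phi psi : smooth phi -> smooth psi -> smooth (phi \* psi).
Proof. by move=> F G k; exact: differentiable_uptoM. Qed.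

Lemma smooth_sum (I : Type) (r : seq I) (P : pred I) (F : I -> Rn -> R) :
  (forall i, smooth (F i)) -> smooth (fun x => \sum_(i <- r | P i) F i x).
Proof.
move=> FS; elim: r => [|i r IH].
  by under eq_fun do rewrite big_nil; exact: smooth_cst.
under eq_fun do rewrite big_cons; case: (P i) => //.
exact: smoothD.
Qed.

Lemma smooth_prod (I : Type) (r : seq I) (P : pred I) (F : I -> Rn -> R) :
  (forall i, smooth (F i)) -> smooth (fun x => \prod_(i <- r | P i) F i x).
Proof.
move=> FS; elim: r => [|i r IH].
  by under eq_fun do rewrite big_nil; exact: smooth_cst.
under eq_fun do rewrite big_cons; case: (P i) => //.
exact: smoothM.
Qed.

Lemma smooth_continuous phi : smooth phi -> continuous phi.
Proof. by move=> /(_ 0%N). Qed.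

Lemma smooth_partial i phi : smooth phi -> smooth (partial i phi).
Proof. by move=> S k; have [_ /(_ i)[]] := S k.+1. Qed.

Lemma smooth_derivable phi i x : smooth phi -> derivable phi x (e_ i).
Proof. by move=> /(_ 1%N)[_ /(_ i)[]]. Qed.

Lemma partialD phi psi i x : smooth phi -> smooth psi ->
  partial i (phi \+ psi) x = partial i phi x + partial i psi x.
Proof. by move=> F G; apply: deriveD; exact: smooth_derivable. Qed.

Lemma partialM phi psi i x : smooth phi -> smooth psi ->
  partial i (phi \* psi) x = phi x * partial i psi x + psi x * partial i phi x.
Proof. by move=> F G; apply: deriveM; exact: smooth_derivable. Qed.

Lemma partial_coord i f x : derivable f (x ord0 i) 1 ->
  partial i (fun x => f (x ord0 i)) x = derive1 f (x ord0 i).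
Proof.
move=> df; have [] := @is_derive_coord i f x ('D_1 f (x ord0 i)).
  exact: derivableP.
by rewrite derive1E.
Qed.

Lemma partial_coord_neq i j f : j != i ->
  partial i (fun x => f (x ord0 j)) = cst 0.
Proof.
move=> ij; apply: partial_indep => h x.
by rewrite !mxE (negbTE ij)/= ?andbF mulr0 add0r.
Qed.

(** A class of one-variable functions stable under derivation is differentiable to every order, by
    induction with [f] generalized. Trigonometric, affine and flat functions all go through such a
    class. *)
Lemma smooth_coord (P : (R -> R) -> Prop) :
  (forall f, P f -> (forall s, derivable f s 1) /\ P (derive1 f)) ->
  forall f i, P f -> smooth (fun x => f (x ord0 i)).
Proof.
move=> PD f i + k; elim: k f => [|k IH] f Pf.
  move=> x /=; apply: (@continuous_comp _ _ _ (fun x : Rn => x ord0 i) f).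
    exact: coord_continuous.
  apply/differentiable_continuous/derivable1_diffP; exact: (PD _ Pf).1.
have [df Pf'] := PD _ Pf; split.
  move=> x /=; apply: (@continuous_comp _ _ _ (fun x : Rn => x ord0 i) f).
    exact: coord_continuous.
  exact/differentiable_continuous/derivable1_diffP.
move=> j; have [<-|ij] := eqVneq i j.
  split=> [x|].
    by have [] := @is_derive_coord i f x _ (derivableP (df (x ord0 i))).
  by rewrite (_ : partial _ _ = fun x => derive1 f (x ord0 i));
    [exact: (IH (derive1 f))|apply/funext => x; exact: partial_coord].
split=> [x|]; last by rewrite partial_coord_neq//; exact: differentiable_upto_cst.
have [] // := @is_derive_indep j (fun x => f (x ord0 i)) x.
by move=> h; rewrite !mxE (negbTE ij)/= ?andbF mulr0 add0r.
Qed.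

End smooth_functions.

(** * Flat functions and cutoffs on an interval *)

Section one_variable.
Context {R : realType}.
Implicit Types (s z r : R).

Lemma is_derive_affine (al be s : R) :
  is_derive s 1 (fun s => al * s + be) al.
Proof.
apply: is_derive_eq.
by rewrite /GRing.scale/=; ring.
Qed.

(** The derivative is written as the same combination with new coefficients, which makes the family
    visibly stable under derivation. *)
Lemma is_derive_trig (al be A B s : R) :
  is_derive s 1 (fun s => A * cos (al * s + be) + B * sin (al * s + be))
    (al * B * cos (al * s + be) + (- al * A) * sin (al * s + be)).
Proof.
have h := is_derive_affine al be s.
have hc : is_derive s 1 (cos \o (fun s => al * s + be)) (al * - sin (al * s + be)).
  by rewrite mulrC; exact: is_derive1_comp.
have hs : is_derive s 1 (sin \o (fun s => al * s + be)) (al * cos (al * s + be)).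
  by rewrite mulrC; exact: is_derive1_comp.
apply: is_derive_eq.
by rewrite /GRing.scale/=; ring.
Qed.

(* [flat 1] is the smooth function exp (- 1 / z) on z > 0; the polynomial factor
   makes the family closed under derivation. *)
Definition flat (p : {poly R}) (z : R) : R :=
  if 0 < z then p.[z^-1] * expR (- z^-1) else 0.

(** The inequality [y / k <= expR (y / k)] raised to the power [k]. *)
Lemma exprn_le_expR (k : nat) (y : R) : 0 <= y ->
  y ^+ k <= k%:R ^+ k * expR y.
Proof.
move=> y0; case: k => [|k]; first by rewrite !expr0 mul1r (le_trans _ (expR_ge1Dx y))// lerDl.
have -> : y = k.+1%:R * (y / k.+1%:R) by rewrite mulrC divfK.
rewrite expRM_natl exprMn ler_pM2l ?exprn_gt0// lerXn2r ?nnegrE ?expR_ge0//.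
  by rewrite divr_ge0.
by rewrite (le_trans _ (expR_ge1Dx _))// lerDr.
Qed.

(** The exponential beats every power of [z^-1]. The monomial of degree [i] is bounded with exponent
    [i.+2], and the two spare powers leave [z ^+ 2], which forces the difference quotient at 0 to
    vanish in the limit. *)
Lemma flat_bound (p : {poly R}) : exists C, forall z, `|flat p z| <= C * z ^+ 2.
Proof.
exists (\sum_(i < size p) `|p`_i| * i.+2%:R ^+ i.+2) => z; rewrite /flat.
case: ifPn => [z0|_]; last first.
  rewrite normr0 mulr_ge0// ?sqr_ge0//; apply: sumr_ge0 => i _.
  by rewrite mulr_ge0// exprn_ge0.
rewrite horner_coef normrM (ger0_norm (expR_ge0 _)).
have y0 : 0 <= z^-1 by rewrite invr_ge0 ltW.
apply: (@le_trans _ _ ((\sum_(i < size p) `|p`_i| * z^-1 ^+ i) * expR (- z^-1))).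
  rewrite ler_wpM2r ?expR_ge0//; apply: (le_trans (ler_norm_sum _ _ _)).
  by apply: ler_sum => i _; rewrite normrM (ger0_norm (exprn_ge0 _ y0)).
rewrite mulr_suml mulr_suml; apply: ler_sum => i _.
rewrite -[leLHS]mulrA -[leRHS]mulrA; apply: ler_wpM2l => //.
move: (i.+2) (leqnSn i.+1) (addn2 i) => m _ mE.
have := exprn_le_expR m y0.
rewrite -ler_pdivrMr ?expR_gt0// -expRN.
have -> : z^-1 ^+ i = z^-1 ^+ m * z ^+ 2.
  by rewrite -mE exprD -mulrA -exprMn mulVf ?gt_eqF// expr1n mulr1.
by move=> h; rewrite mulrAC; apply: ler_wpM2r => //; exact: sqr_ge0.
Qed.

(** For [z > 0], deriving either factor brings out [z ^- 2], hence the ['X^2]. At 0 the derivative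
    is 0 by [flat_bound]. *)
Lemma is_derive_flat (p : {poly R}) (z : R) :
  is_derive z 1 (flat p) (flat ((p - deriv p) * 'X^2) z).
Proof.
have [z0|z0|->] := ltgtP z 0.
- rewrite {2}/flat ltNge (ltW z0)/=.
  apply: (@near_eq_is_derive _ _ _ (cst 0)) => //.
    near=> y; rewrite /flat ltNge (_ : y <= 0)//; apply: ltW.
    by near: y; exact: lt_nbhsl.
- rewrite {2}/flat z0.
  apply: (@near_eq_is_derive _ _ _ (fun z => p.[z^-1] * expR (- z^-1))).
    near=> y; rewrite /flat (_ : 0 < y)//.
    by near: y; exact: lt_nbhsr.
  have z1 : z != 0 by rewrite gt_eqF.
  have hV : is_derive z 1 (@GRing.inv R) (- z ^- 2).
    split; first exact: (derivableV (f := id)).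
    by rewrite (deriveV (f := id))// derive_id scaler1.
  have hN : is_derive z 1 (fun z : R => - z^-1) (z ^- 2).
    by apply: is_derive_eq; rewrite opprK.
  have hE : is_derive z 1 (expR \o (fun z : R => - z^-1)) (expR (- z^-1) * z ^- 2).
    exact: is_derive1_comp.
  have hp : is_derive z 1 (horner p \o (@GRing.inv R)) ((deriv p).[z^-1] * - z ^- 2).
    apply: is_derive1_comp.
  apply: is_derive_eq.
  rewrite /GRing.scale/= hornerM hornerXn hornerD hornerN.
  by move: p.[z^-1] (deriv p).[z^-1] (expR _) => u v w; field.
- rewrite {2}/flat ltxx.
  have [C HC] := flat_bound p.
  have C0 : 0 <= C.
    by have := HC 1; rewrite expr1n mulr1; exact: le_trans.
  have q0 : (fun h => h^-1 *: (flat p (h *: 1 + 0) - flat p 0)) @ (0:R)^' --> (0:R).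
    apply/cvgr0Pnorm_le => /= e e0; near=> h.
    rewrite scaler1 addr0 /(flat p 0) ltxx subr0 normrZ normfV.
    have h0 : 0 < `|h|.
      by rewrite normr_gt0; near: h; exact: nbhs_dnbhs_neq.
    rewrite mulrC ler_pdivrMr// (le_trans (HC h))//.
    rewrite -real_normK ?num_real// expr2 mulrA ler_wpM2r//.
    rewrite (@le_trans _ _ ((C + 1) * `|h|))// ?ler_wpM2r// ?lerDl//.
    rewrite mulrC -ler_pdivlMr; last by rewrite ltr_wpDl.
    near: h; apply: dnbhs0_le; by rewrite divr_gt0// ltr_wpDl.
  split; first by apply/cvg_ex; exists 0.
  exact: cvg_lim q0.
Unshelve. all: by end_near. Qed.

Lemma smooth_flat {n : nat} (p : {poly R}) (al be : R) (i : 'I_n) :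
  smooth (fun x : 'rV[R]_n => flat p (al * x ord0 i + be)).
Proof.
pose P f := exists p, f = fun s => flat p (al * s + be).
apply: (@smooth_coord _ _ P _ (fun s => flat p (al * s + be))) => [f [q ->]|]; last by exists p.
have dq s : is_derive s 1 (flat q \o (fun s => al * s + be))
    (flat ((q - deriv q) * 'X^2) (al * s + be) * al).
  have h := is_derive_affine al be s; have h' := is_derive_flat q (al * s + be).
  exact: is_derive1_comp.
split=> [s|]; first by have [] := dq s.
exists (al *: ((q - deriv q) * 'X^2)); apply/funext => s.
rewrite derive1E; have [_ ->] := dq s.
by rewrite /flat; case: ifP => _; [rewrite hornerZ; ring|rewrite mul0r].
Qed.

Lemma flat1_ge0 z : 0 <= flat 1 z.
Proof. by rewrite /flat; case: ifP => // _; rewrite hornerC mul1r expR_ge0. Qed.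

Lemma flat1_le1 z : flat 1 z <= 1.
Proof.
rewrite /flat; case: ifP => // z0.
by rewrite hornerC mul1r expR_le1 oppr_le0 invr_ge0 ltW.
Qed.

(** [flat 'X^2] is the derivative of [flat 1]. At [z = k.+1%:R * de - 1] this says that the distance
    [de] to an endpoint times the derivative of the cutoff is bounded uniformly in [k]. In terms of
    [y = z^-1] it reads [y + y ^+ 2 <= 3 * expR y]. *)
Lemma flatX2_bound z : 0 <= (z + 1) * flat 'X^2 z <= 3.
Proof.
rewrite /flat; case: ifPn => [z0|_]; last by rewrite mulr0 lexx ler0n.
have z1 : z != 0 by rewrite gt_eqF.
rewrite hornerXn expRN; apply/andP; split.
  by rewrite !mulr_ge0 ?exprn_ge0 ?invr_ge0 ?expR_ge0// ?addr_ge0// ltW.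
rewrite mulrA ler_pdivrMr ?expR_gt0//.
have -> : (z + 1) * z^-1 ^+ 2 = z^-1 + z^-1 ^+ 2 by field.
have y0 : 0 <= z^-1 by rewrite invr_ge0 ltW.
have := expR_ge1Dx z^-1; have := expR_ge1Dxn 1 y0.
rewrite (_ : 2`! = 2)%N//; move: (expR _) (z^-1 ^+ 2) => E y2; lra.
Qed.

Lemma cvg_scaled_shift (de : R) : 0 < de ->
  (k.+1%:R * de - 1) @[k --> \oo] --> +oo.
Proof.
move=> de0; apply/cvgryPge => A; near=> k.
rewrite lerBrDr -ler_pdivrMr//; apply: le_trans (_ : k%:R <= _); last by rewrite ler_nat.
by near: k; exact: nbhs_infty_ger.
Unshelve. all: by end_near. Qed.

Lemma cvg_scaled_shiftV (de : R) : 0 < de ->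
  (k.+1%:R * de - 1)^-1 @[k --> \oo] --> (0 : R).
Proof.
move=> de0; apply/(@gtr0_cvgV0 _ _ _ _ (fun k : nat => k.+1%:R * de - 1)).
  by have /cvgryPgt := cvg_scaled_shift de0; exact.
exact: cvg_scaled_shift.
Qed.

Lemma cvg_flat1 (de : R) : 0 < de ->
  flat 1 (k.+1%:R * de - 1) @[k --> \oo] --> (1 : R).
Proof.
move=> de0.
have h : expR (- (k.+1%:R * de - 1)^-1) @[k --> \oo] --> expR (- 0 : R).
  apply: continuous_cvg; first exact: continuous_expR.
  by apply: cvgN; exact: cvg_scaled_shiftV.
rewrite oppr0 expR0 in h.
apply: cvg_trans h; apply: near_eq_cvg; near=> k.
rewrite /flat ifT ?hornerC ?mul1r//.
by near: k; have /cvgryPgt := cvg_scaled_shift de0; exact.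
Unshelve. all: by end_near. Qed.

Lemma cvg_flatX2 (de : R) : 0 < de ->
  (k.+1%:R * de * flat 'X^2 (k.+1%:R * de - 1)) @[k --> \oo] --> (0 : R).
Proof.
move=> de0.
pose y k : R := (k.+1%:R * de - 1)^-1.
have y0 : y k @[k --> \oo] --> (0 : R) by exact: cvg_scaled_shiftV.
have h : ((y k + y k * y k) * expR (- y k)) @[k --> \oo] --> (0 + 0 * 0) * expR (- 0 : R).
  apply: cvgM; first by apply: cvgD => //; apply: cvgM.
  apply: continuous_cvg; first exact: continuous_expR.
  exact: cvgN.
rewrite mul0r addr0 mul0r in h.
apply: cvg_trans h; apply: near_eq_cvg; near=> k.
have z0 : 0 < k.+1%:R * de - 1.
  by near: k; have /cvgryPgt := cvg_scaled_shift de0; exact.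
rewrite /flat z0 hornerXn /y; set z := _ - 1 in z0 *.
have -> : k.+1%:R * de = z + 1 by rewrite /z subrK.
rewrite mulrA; congr (_ * _).
have z1 : z != 0 by rewrite gt_eqF.
by field.
Unshelve. all: by end_near. Qed.

(* As k grows this tends to 1 on ]a, b[, and its derivative stays bounded and
   tends to 0 once multiplied by the distance to the endpoints. *)
Definition cutoff (a b : R) (k : nat) (s : R) : R :=
  flat 1 (k.+1%:R * (s - a) - 1) * flat 1 (k.+1%:R * (b - s) - 1).

Definition dcutoff (a b : R) (k : nat) (s : R) : R :=
  k.+1%:R * flat 'X^2 (k.+1%:R * (s - a) - 1) * flat 1 (k.+1%:R * (b - s) - 1)
  - flat 1 (k.+1%:R * (s - a) - 1) * (k.+1%:R * flat 'X^2 (k.+1%:R * (b - s) - 1)).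

Lemma cutoff_affine a b k s : cutoff a b k s =
  flat 1 (k.+1%:R * s + (- (k.+1%:R * a) - 1)) *
  flat 1 (- k.+1%:R * s + (k.+1%:R * b - 1)).
Proof. by rewrite /cutoff; congr (flat _ _ * flat _ _); ring. Qed.

Lemma smooth_cutoff {n : nat} (a b : R) k (i : 'I_n) :
  smooth (fun x : 'rV[R]_n => cutoff a b k (x ord0 i)).
Proof.
under eq_fun do rewrite cutoff_affine.
by apply: smoothM; exact: smooth_flat.
Qed.

Lemma is_derive_flat1_affine (al be s : R) :
  is_derive s 1 (fun s => flat 1 (al * s + be)) (flat 'X^2 (al * s + be) * al).
Proof.
have h := is_derive_affine al be s; have h' := is_derive_flat 1 (al * s + be).
rewrite (_ : _ * 'X^2 = 'X^2) in h'; last by rewrite derivC subr0 mul1r.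
exact: is_derive1_comp.
Qed.

Lemma is_derive_cutoff a b k s : is_derive s 1 (cutoff a b k) (dcutoff a b k s).
Proof.
rewrite (_ : cutoff a b k = fun s => flat 1 (k.+1%:R * s + (- (k.+1%:R * a) - 1)) *
  flat 1 (- k.+1%:R * s + (k.+1%:R * b - 1))); last first.
  by apply/funext => x; rewrite cutoff_affine.
have h1 := is_derive_flat1_affine k.+1%:R (- (k.+1%:R * a) - 1) s.
have h2 := is_derive_flat1_affine (- k.+1%:R) (k.+1%:R * b - 1) s.
apply: is_derive_eq.
rewrite /GRing.scale/= /dcutoff.
have -> : k.+1%:R * s + (- (k.+1%:R * a) - 1) = k.+1%:R * (s - a) - 1 by ring.
have -> : - k.+1%:R * s + (k.+1%:R * b - 1) = k.+1%:R * (b - s) - 1 by ring.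
by ring.
Qed.

Lemma cutoff_ge0 a b k s : 0 <= cutoff a b k s.
Proof. by rewrite mulr_ge0// flat1_ge0. Qed.

Lemma cutoff_le1 a b k s : cutoff a b k s <= 1.
Proof. by rewrite mulr_ile1// ?flat1_ge0// flat1_le1. Qed.

(** The shift by 1 in the argument of [flat] keeps the support at distance at least [k.+1%:R^-1]
    from both endpoints, so that it lies in a compact part of the open interval. *)
Lemma cutoff_supp a b k s : cutoff a b k s != 0 ->
  a + k.+1%:R^-1 <= s <= b - k.+1%:R^-1.
Proof.
rewrite mulf_eq0 negb_or /flat; case: ifPn; rewrite ?eqxx// => h1.
case: ifPn; rewrite ?eqxx ?andbF// => h2 _.
move: h1 h2; rewrite !subr_gt0 -!ltr_pdivrMl// !mulr1 => h1 h2.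
by move: (k.+1%:R^-1) h1 h2 => q h1 h2; apply/andP; split; lra.
Qed.

Lemma cvg_cutoff a b s : a < s < b -> cutoff a b k s @[k --> \oo] --> (1 : R).
Proof.
move=> /andP[sa sb]; rewrite -[1]mulr1.
by apply: cvgM; apply: cvg_flat1; rewrite subr_gt0.
Qed.

(** Linear vanishing of [v] at both endpoints absorbs the growth of [dcutoff]. Each of its two
    terms, one per endpoint, contributes [3 * C] by [flatX2_bound]. *)
Lemma dcutoff_bound a b k s (v C : R) : a < s < b ->
  `|v| <= C * (s - a) -> `|v| <= C * (b - s) -> `|v * dcutoff a b k s| <= 6 * C.
Proof.
move=> /andP[sa sb] va vb.
have C0 : 0 <= C.
  have : 0 <= C * (s - a) by apply: le_trans va.
  by rewrite pmulr_lge0// subr_gt0.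
have aux (w de r : R) : 0 < de -> `|w| <= C * de -> 0 <= r <= 1 ->
    `|w * (k.+1%:R * flat 'X^2 (k.+1%:R * de - 1) * r)| <= 3 * C.
  move=> de0 wC /andP[r0 r1].
  have := flatX2_bound (k.+1%:R * de - 1); rewrite subrK => /andP[F0 F2].
  have G0 : 0 <= k.+1%:R * flat 'X^2 (k.+1%:R * de - 1).
    rewrite mulr_ge0// /flat; case: ifP => // _.
    by rewrite hornerXn mulr_ge0 ?expR_ge0// sqr_ge0.
  rewrite normrM (ger0_norm (mulr_ge0 G0 r0)).
  apply: (@le_trans _ _ (C * de * (k.+1%:R * flat 'X^2 (k.+1%:R * de - 1) * 1))).
    by apply: ler_pM => //; [rewrite mulr_ge0|rewrite ler_wpM2l].
  rewrite mulr1 -mulrA [3 * C]mulrC ler_wpM2l//.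
  by rewrite mulrA [de * _]mulrC.
rewrite /dcutoff mulrBr (le_trans (ler_normB _ _))//.
rewrite (_ : 6 * C = 3 * C + 3 * C); last by ring.
apply: lerD; first by apply: aux => //; rewrite ?subr_gt0// flat1_ge0 flat1_le1.
rewrite [flat 1 _ * _]mulrC.
by apply: aux => //; rewrite ?subr_gt0// flat1_ge0 flat1_le1.
Qed.

Lemma cvg_dcutoff a b s (v : R) : a < s < b ->
  v * dcutoff a b k s @[k --> \oo] --> (0 : R).
Proof.
move=> /andP[sa sb].
have aux (de : R) : 0 < de -> (k.+1%:R * flat 'X^2 (k.+1%:R * de - 1)) @[k --> \oo] --> (0 : R).
  move=> de0.
  have h : de^-1 * (k.+1%:R * de * flat 'X^2 (k.+1%:R * de - 1)) @[k --> \oo] --> de^-1 * 0.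
    by apply: cvgM; [exact: cvg_cst|exact: cvg_flatX2].
  rewrite mulr0 in h; apply: cvg_trans h; apply: near_eq_cvg; near=> k.
  by rewrite /=; field; rewrite gt_eqF.
rewrite -(mulr0 v); apply: cvgM; first exact: cvg_cst.
rewrite -(subr0 0) -{1}(mul0r 1) -(mul1r 0).
apply: cvgB; apply: cvgM; rewrite ?mul1r; (try by apply: aux; rewrite subr_gt0).
  by apply: cvg_flat1; rewrite subr_gt0.
by apply: cvg_flat1; rewrite subr_gt0.
Unshelve. all: by end_near. Qed.

Lemma smooth_trig {n : nat} (al be A B : R) (i : 'I_n) :
  smooth (fun x : 'rV[R]_n =>
    A * cos (al * x ord0 i + be) + B * sin (al * x ord0 i + be)).
Proof.
pose P f := exists A B, f = fun s => A * cos (al * s + be) + B * sin (al * s + be).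
apply: (@smooth_coord _ _ P _
  (fun s => A * cos (al * s + be) + B * sin (al * s + be))); last by exists A, B.
move=> f [A' [B' ->]]; split=> [s|].
  by have [] := is_derive_trig al be A' B' s.
exists (al * B'), (- al * A'); apply/funext => s.
by rewrite derive1E; have [_ ->] := is_derive_trig al be A' B' s.
Qed.

Lemma smooth_affine {n : nat} (al be : R) (i : 'I_n) :
  smooth (fun x : 'rV[R]_n => al * x ord0 i + be).
Proof.
pose P (f : R -> R) := exists al be, f = fun s => al * s + be.
apply: (@smooth_coord _ _ P _ (fun s => al * s + be)); last by exists al, be.
move=> f [al' [be' ->]]; split=> [s|].
  by have [] := is_derive_affine al' be' s.
exists 0, al'; apply/funext => s.
by rewrite derive1E; have [_ ->] := is_derive_affine al' be' s; rewrite mul0r add0r.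
Qed.

End one_variable.

(** * Borel sets of R^n, boxes and compactness *)

Section measurability.
Context {R : realType} {n : nat}.
Local Notation Rn := 'rV[R]_n.

Lemma exists_nat_gt_coord (v : Rn) : exists k : nat, forall j, `|v ord0 j| < k%:R.
Proof.
exists (\sum_j Num.bound `|v ord0 j|)%N => j.
apply: lt_le_trans (archi_boundP (normr_ge0 _)) _.
by rewrite ler_nat (bigD1 j)//= leq_addr.
Qed.

Lemma boxI (a b c d : Rn) : box a b `&` box c d =
  box (\row_i Num.max (a ord0 i) (c ord0 i)) (\row_i Num.min (b ord0 i) (d ord0 i)).
Proof.
apply/seteqP; split=> [x [ab cd] i|x abcd].
  by rewrite !mxE gt_max lt_min; have /andP[-> ->] := ab i; have /andP[-> ->] := cd i.
by split=> i; have := abcd i; rewrite !mxE gt_max lt_min =>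
  /andP[/andP[h1 h2] /andP[h3 h4]]; apply/andP.
Qed.

(** A generating pi-system that contains an exhaustion of the space by sets of finite measure: what
    uniqueness of measures and Dynkin induction require. *)
Definition boxes : set (set Rn) := [set A | exists a b : Rn, A = box a b].

Lemma setI_closed_boxes : setI_closed boxes.
Proof. by move=> _ _ [a [b ->]] [c [d ->]]; rewrite boxI; eexists; eexists. Qed.

Lemma rV_measurableE : @measurable _ Rn = <<s boxes >>.
Proof.
apply/seteqP; split=> A.
  suff : g_sigma_preimage (@coord_rV R n) `<=` <<s boxes >> by exact.
  apply: smallest_sub; first exact: smallest_sigma_algebra.
  move=> B; rewrite -bigcup_seq/= => -[i _ [Y mY <-]].
  have mc : measurable_fun [set: g_sigma_algebraType boxes]
      (coord_rV i : g_sigma_algebraType boxes -> R).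
    apply: (measurability _ (RGenOInfty.measurableE R)) => _ [_ [x ->] <-].
    rewrite setTI.
    (* The half-space is exhausted by bounded boxes: coordinate [i] runs between [x] and [k], the
       others between [- k] and [k]. *)
    rewrite (_ : _ @^-1` _ = \bigcup_k box
      (\row_j if j == i then x else - k%:R) (\row_j k%:R : Rn)).
      apply: bigcupT_measurable => k; apply: sub_sigma_algebra.
      by eexists; eexists.
    apply/seteqP; split=> [v|v [k _ vk]]/=.
      rewrite in_itv/= andbT => xv.
      have [k vk] := exists_nat_gt_coord v.
      exists k => // j; rewrite !mxE.
      have := vk j; rewrite ltr_norml => /andP[v1 v2].
      by case: eqP => [->|_]; rewrite ?xv ?v1 (le_lt_trans (ler_norm _)).
    by rewrite in_itv/= andbT; have := vk i; rewrite !mxE eqxx => /andP[].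
  by have := mc measurableT _ mY; exact.
apply: smallest_sub => [|_ [a [b ->]]]; last exact: measurable_box.
exact: sigma_algebra_measurable.
Qed.

(** The sigma-algebra is generated by coordinates and not by the topology. The link is that an open
    set is the countable union of the boxes with rational corners that it contains. *)
Lemma open_measurable_rV (U : set Rn) : open U -> measurable U.
Proof.
move=> oU.
pose F (pq : 'rV[rat]_n * 'rV[rat]_n) : set Rn :=
  let B := box (map_mx ratr pq.1) (map_mx ratr pq.2) in
  if `[< B `<=` U >] then B else set0.
rewrite (_ : U = \bigcup_pq F pq).
  apply: countable_bigcupT_measurable; first exact: countableP.
  by move=> pq; rewrite /F; case: ifP => // _; exact: measurable_box.
apply/seteqP; split=> [x Ux|x [pq _]]; last first.
  by rewrite /F; case: ifP => // /asboolP; exact.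
have /nbhs_ballP[e /= e0 xeU] : nbhs x U by exact: open_nbhs_nbhs.
have Hp i : exists q : rat, (x ord0 i - e < ratr q < x ord0 i)%R.
  have [|q] := @rat_in_itvoo R (x ord0 i - e) (x ord0 i).
    by rewrite ltrBlDr ltrDl.
  by rewrite in_itv/=; exists q.
have Hq i : exists q : rat, (x ord0 i < ratr q < x ord0 i + e)%R.
  have [|q] := @rat_in_itvoo R (x ord0 i) (x ord0 i + e).
    by rewrite ltrDl.
  by rewrite in_itv/=; exists q.
have [p px] := choice Hp; have [q qx] := choice Hq.
exists (\row_i p i, \row_i q i) => //.
have xB : box (map_mx ratr (\row_i p i)) (map_mx ratr (\row_i q i)) x.
  by move=> i; rewrite !mxE; have /andP[_ ->] := px i; have /andP[-> _] := qx i.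
rewrite /F ifT//=; apply/asboolP => y yB; apply: xeU.
split=> // i j; rewrite (ord1 i).
have := yB j; rewrite !mxE => /andP[yp yq].
have /andP[p1 p2] := px j; have /andP[q1 q2] := qx j.
suff : - e < x ord0 j - y ord0 j < e by rewrite /ball/= ltr_norml.
have h1 := lt_trans yq q2; have h2 := lt_trans p1 yp.
by move: (x ord0 j) (y ord0 j) h1 h2 => s t h1 h2; apply/andP; split; lra.
Qed.

Lemma continuous_measurable_rV (f : Rn -> R) : continuous f ->
  measurable_fun [set: Rn] f.
Proof.
move=> /continuousP cf; apply: (measurability _ (RGenOpens.measurableE R)).
move=> _ [_ [a [b ->]] <-]; rewrite setTI; apply: open_measurable_rV.
by apply: cf; exact: interval_open.
Qed.

Lemma closed_box_compact (a b : Rn) :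
  compact [set x : Rn | forall i, a ord0 i <= x ord0 i <= b ord0 i].
Proof.
have := @rV_compact R n (fun i => `[a ord0 i, b ord0 i]%classic)
  (fun i => @segment_compact _ _ _).
by congr (compact _); apply/seteqP; split=> x /= H i; have := H i; rewrite in_itv.
Qed.

Lemma continuous_bounded_closed_box (a b : Rn) (f : Rn -> R) : continuous f ->
  exists2 M : R, 0 <= M & forall x : Rn, (forall i, a ord0 i <= x ord0 i <= b ord0 i) ->
    `|f x| <= M.
Proof.
move=> cf; have cpt := @closed_box_compact a b.
have /compact_bounded[M [_ HM]] : compact
    (f @` [set x : Rn | forall i, a ord0 i <= x ord0 i <= b ord0 i]).
  apply: continuous_compact => //.
  by apply: continuous_subspaceT.
exists (`|M| + 1); first by rewrite addr_ge0.
move=> x xab; apply: (HM (`|M| + 1)); last by exists x.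
by rewrite (le_lt_trans (ler_norm _))// ltrDl.
Qed.

Lemma box_empty (a b : Rn) (j : 'I_n) : b ord0 j <= a ord0 j -> box a b = set0.
Proof.
move=> ba; apply/seteqP; split=> // x /(_ j) /andP[ax xb].
by have := lt_trans ax xb; rewrite ltNge ba.
Qed.

Lemma box_finite_measure (a b : Rn) : (lebesgue_rV n (box a b) < +oo)%E.
Proof.
have [[j ba]|ab] := pselect (exists j, b ord0 j < a ord0 j)%R.
  by rewrite (box_empty (ltW ba)) measure0.
rewrite lebesgue_rV_box ?ltry// => j.
by rewrite leNgt; apply: contra_notN ab => ?; exists j.
Qed.

End measurability.

(** * Splitting Lebesgue measure along an arbitrary coordinate *)

Section slicing.
Context {R : realType} {n : nat} (i : 'I_n.+1).
Implicit Types (a b : 'rV[R]_n.+1).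

(** [lebesgue_rV] splits off coordinate 0 by construction, whereas the faces of a box are orthogonal
    to every axis: the same splitting is needed for each [i]. *)
Definition slice (p : measurableTypeR R * 'rV[R]_n) : 'rV[R]_n.+1 :=
  @insert R n.+1 i p.1 p.2.

Lemma measurable_slice : measurable_fun [set: _] slice.
Proof. exact: (@measurable_insert R _ _ n.+1). Qed.

Lemma insertE (s : R) (y : 'rV[R]_n) : @insert R n.+1 i s y ord0 i = s.
Proof. by rewrite mxE unlift_none. Qed.

Lemma insert_lift (s : R) (y : 'rV[R]_n) j :
  @insert R n.+1 i s y ord0 (lift i j) = y ord0 j.
Proof. by rewrite mxE liftK. Qed.

Lemma box_insert a b (s : R) (y : 'rV[R]_n) :
  box a b (@insert R n.+1 i s y) <->
  a ord0 i < s < b ord0 i /\ box (col' i a) (col' i b) y.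
Proof.
split=> [ab|[sab yab] j].
  split; first by have := ab i; rewrite insertE.
  by move=> j; have := ab (lift i j); rewrite insert_lift !mxE.
have [k ->|->] := unliftP i j; last by rewrite insertE.
by rewrite insert_lift; have := yab k; rewrite !mxE.
Qed.

Lemma slice_box a b : slice @^-1` box a b =
  `]a ord0 i, b ord0 i[ `*` box (col' i a) (col' i b).
Proof.
apply/seteqP; split=> [[s y]/= /box_insert[]|[s y]/=[]] sab yab.
  by split => //; rewrite /= in_itv.
by apply/box_insert; split => //; move: sab; rewrite /= in_itv.
Qed.

(* The measure instance of a pushforward depends on a proof of measurability of
   the map, which inference does not find: hence HB's constant below. *)
Lemma lebesgue_rV_slice (A : set 'rV[R]_n.+1) : measurable A ->
  lebesgue_rV n.+1 A =
  pushforward (@lebesgue_measure R \x lebesgue_rV n)%E slice A.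
Proof.
pose m2 : {measure set 'rV[R]_n.+1 -> \bar R} :=
  measure_function_pushforward__canonical__measure_function_Measure
    (@lebesgue_measure R \x lebesgue_rV n)%E measurable_slice.
rewrite -[RHS]/(m2 A).
apply: (@measure_unique _ R 'rV[R]_n.+1 boxes
  (fun k => box (\row__ - k%:R) (\row__ k%:R)) rV_measurableE).
- exact: setI_closed_boxes.
- by move=> k; eexists; eexists.
- apply/seteqP; split=> // x _; have [k xk] := exists_nat_gt_coord x.
  by exists k => // j; rewrite !mxE -ltr_norml.
- move=> _ [a [b ->]]; rewrite /m2/= /pushforward slice_box.
  have [[j ba]|ab] := pselect (exists j, b ord0 j < a ord0 j).
    rewrite (box_empty (ltW ba)) measure0.
    case: (unliftP i j) => [ij jE|ji].
      rewrite (box_empty (j := ij)) ?setX0 ?measure0//.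
      by rewrite !mxE -jE ltW.
    rewrite set_itv_ge ?set0X ?measure0// -ji bnd_simp -leNgt; exact: ltW.
  have {}ab j : a ord0 j <= b ord0 j.
    by rewrite leNgt; apply: contra_notN ab => ?; exists j.
  rewrite product_measure1E ?measurable_itv//; last exact: measurable_box.
  rewrite !lebesgue_rV_box//; last by move=> j; rewrite !mxE.
  rewrite (bigD1_ord i)//= EFinM; congr (_ * _)%E; last first.
    by congr (_%:E); apply: eq_bigr => j _; rewrite !mxE.
  apply/esym/(etrans (lebesgue_measure_itv _)).
  rewrite /= lte_fin; case: ltP => // ba.
  by have := ab i; rewrite le_eqVlt ltNge ba orbF => /eqP ->; rewrite subrr.
- by move=> k; exact: (@box_finite_measure R n.+1).
Qed.

End slicing.

(** * Integrals over a box and Fubini's theorem *)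

Section box_integral.
Context {R : realType}.
Local Open Scope ereal_scope.

Lemma integrable_box_bounded {n : nat} (a b : 'rV[R]_n) (f : 'rV[R]_n -> R) (M : R) :
  measurable_fun (box a b) f -> (forall x, box a b x -> `|f x| <= M)%R ->
  (lebesgue_rV n).-integrable (box a b) (EFin \o f).
Proof.
move=> mf fM; apply: measurable_bounded_integrable => //.
- exact: measurable_box.
- exact: box_finite_measure.
- by exists M; split; [exact: num_real|move=> y My x /fM /le_trans; apply; exact: ltW].
Qed.

Lemma box_closed {n : nat} (a b x : 'rV[R]_n) : box a b x ->
  forall i, (a ord0 i <= x ord0 i <= b ord0 i)%R.
Proof. by move=> abx i; have /andP[/ltW-> /ltW->] := abx i. Qed.

Lemma integrable_box_continuous {n : nat} (a b : 'rV[R]_n) (f : 'rV[R]_n -> R) :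
  continuous f -> (lebesgue_rV n).-integrable (box a b) (EFin \o f).
Proof.
move=> cf; have [M _ fM] := continuous_bounded_closed_box a b cf.
apply: (@integrable_box_bounded _ _ _ _ M).
  by apply: measurable_funTS; exact: continuous_measurable_rV.
by move=> x /box_closed; exact: fM.
Qed.

(** The chosen coordinate is innermost, so that the fundamental theorem of calculus can be applied
    on each segment and leaves integrals over two opposite faces. *)
Lemma integral_box_slice {n : nat} (i : 'I_n.+1) (a b : 'rV[R]_n.+1)
    (f : 'rV[R]_n.+1 -> R) :
  measurable_fun setT f ->
  (lebesgue_rV n.+1).-integrable (box a b) (EFin \o f) ->
  \int[lebesgue_rV n.+1]_(x in box a b) (f x)%:E =
  \int[lebesgue_rV n]_(y in box (col' i a) (col' i b))
    \int[lebesgue_measure]_(s in `]a ord0 i, b ord0 i[) (f (@insert R n.+1 i s y))%:E.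
Proof.
move=> mf intf.
have mB := measurable_box a b.
pose m2 : {measure set 'rV[R]_n.+1 -> \bar R} :=
  measure_function_pushforward__canonical__measure_function_Measure
    (@lebesgue_measure R \x lebesgue_rV n)%E (@measurable_slice _ _ i).
rewrite (@eq_measure_integral _ _ _ _ m2); last by move=> A mA _; exact: (lebesgue_rV_slice i).
have mSB : measurable (slice i @^-1` box a b).
  by rewrite -[X in measurable X]setTI; exact: (@measurable_slice R n i).
have mfs : measurable_fun [set: measurableTypeR R * 'rV[R]_n] (f \o slice i).
  exact: measurableT_comp mf (@measurable_slice R n i).
have int2 : (lebesgue_measure \x lebesgue_rV n)%E.-integrable (slice i @^-1` box a b)
    ((EFin \o f) \o slice i).
  move/integrableP: intf => [mf' foo]; apply/integrableP; split.
    by apply: measurable_funTS; apply/measurable_EFinP.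
  rewrite (@eq_measure_integral _ _ _ _ m2) in foo; last first.
    by move=> A mA _; exact: (lebesgue_rV_slice i).
  rewrite (@ge0_integral_pushforward _ _ _ _ _ _ (@measurable_slice _ _ i)) in foo => //.
  exact: measurableT_comp.
rewrite (@integral_pushforward _ _ _ _ _ _ (@measurable_slice _ _ i))//; last first.
  by apply/measurable_EFinP.
rewrite slice_box in int2 mSB *.
rewrite integral_mkcond -integral21_prod_meas1; last exact/(integrable_mkcond _ mSB).
rewrite [RHS]integral_mkcond; apply: eq_integral => y _.
rewrite /patch; case: ifPn => yB.
  rewrite [RHS]integral_mkcond; apply: eq_integral => s _.
  rewrite /patch in_setX/= yB andbT.
  by [].
apply: integral0_eq => s _; rewrite in_setX/= (negbTE yB) andbF//.
Qed.

End box_integral.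

(** * Divergence theorem in one coordinate direction *)

Section divergence.
Context {R : realType} {n : nat} (i : 'I_n.+1) (a b : 'rV[R]_n.+1).
Local Notation ins := (@insert R n.+1 i).
Local Notation boxi := (box (col' i a) (col' i b)).
Implicit Types (psi : 'rV[R]_n.+1 -> R) (y : 'rV[R]_n).

Lemma insert_shift (h s : R) y :
  ins (h + s) y = h *: delta_mx ord0 i + ins s y.
Proof.
apply/rowP => j; rewrite !mxE eqxx/=.
case: unliftP => [k ->|->]; first by rewrite eq_sym (negbTE (neq_lift _ _)) mulr0 add0r.
by rewrite eqxx mulr1.
Qed.

Lemma continuous_insert y : continuous (ins ^~ y).
Proof.
move=> s; apply/(@cvg_ballP _ _ _ (nbhs (s : R))) => e e0.
have : nbhs (s : R) (ball (s : R) e) by exact: nbhsx_ballx.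
apply: (@filterS _ (nbhs (s : R))) => z sz.
by split=> // j k; rewrite !mxE; case: (unlift i k) => [l|//]; exact: ballxx.
Qed.

Lemma continuous_insert_snd (s : R) :
  continuous (ins s : 'rV[R]_n -> 'rV[R]_n.+1).
Proof.
move=> y; apply/(@cvg_ballP _ _ _ (nbhs (y : 'rV[R]_n))) => e e0.
have : nbhs (y : 'rV[R]_n) (ball (y : 'rV[R]_n) e) by exact: nbhsx_ballx.
apply: (@filterS _ (nbhs (y : 'rV[R]_n))) => z [_ yz].
split=> // j k; rewrite !mxE; case: (unlift i k) => [l|]; last exact: ballxx.
exact: yz.
Qed.

Lemma is_derive_insert psi y (s : R) : smooth psi ->
  is_derive s 1 (fun s => psi (ins s y)) (partial i psi (ins s y)).
Proof.
move=> Spsi; have dpsi := @smooth_derivable _ _ _ i (ins s y) Spsi.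
have E : (fun h => h^-1 *: (psi (ins (h *: 1 + s) y) - psi (ins s y))) =
    (fun h => h^-1 *: (psi (h *: delta_mx ord0 i + ins s y) - psi (ins s y))).
  by apply/funext => h; rewrite -insert_shift scaler1.
by split; [rewrite /derivable E|rewrite /derive E].
Qed.

Lemma Rintegral_partial psi : a ord0 i < b ord0 i -> smooth psi ->
  \int[lebesgue_rV n.+1]_(x in box a b) partial i psi x =
  \int[lebesgue_rV n]_(y in boxi) psi (ins (b ord0 i) y) -
  \int[lebesgue_rV n]_(y in boxi) psi (ins (a ord0 i) y).
Proof.
move=> ab Spsi.
have cpsi := smooth_continuous Spsi.
have cp := smooth_continuous (smooth_partial i Spsi).
have ci s : continuous (fun y => psi (ins s y)).
  by move=> y; apply: continuous_comp; [exact: continuous_insert_snd|exact: cpsi].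
rewrite -RintegralB; last 3 first.
- exact: measurable_box.
- exact: integrable_box_continuous.
- exact: integrable_box_continuous.
rewrite /Rintegral (integral_box_slice i); last 2 first.
- exact: continuous_measurable_rV.
- exact: integrable_box_continuous.
congr fine; apply: eq_integral => y _.
have cs : continuous (fun s => partial i psi (ins s y)).
  by move=> s; apply: continuous_comp; [exact: continuous_insert|exact: cp].
have cs' : continuous (fun s => psi (ins s y)).
  by move=> s; apply: continuous_comp; [exact: continuous_insert|exact: cpsi].
have ms (D : set R) : measurable_fun D (fun s => (partial i psi (ins s y))%:E).
  by apply/measurable_EFinP; apply: measurable_funTS; exact: continuous_measurable_fun.
(* The fundamental theorem is stated on closed intervals; adding the endpoints does not change the
   integral. *)
rewrite integral_itv_bndo_bndc// integral_itv_obnd_cbnd//.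
rewrite (continuous_FTC2 ab (F := fun s => psi (ins s y)))//.
- exact: continuous_subspaceT.
- split.
  + by move=> s _; have [] := is_derive_insert y s Spsi.
  + by apply: cvg_at_right_filter; exact: cs'.
  + by apply: cvg_at_left_filter; exact: cs'.
- by move=> s _; rewrite derive1E; have [_ ->] := is_derive_insert y s Spsi.
Qed.

End divergence.

(** * Integration against restrictions and sums of measures *)

Section measure_combinations.
Context d (T : measurableType d) (R : realType).
Local Open Scope ereal_scope.
Implicit Types (f : T -> \bar R).

Lemma integral_mrestr (mu : {measure set T -> \bar R}) (D : set T)
    (mD : measurable D) f : measurable_fun setT f ->
  \int[mrestr mu mD]_x f x = \int[mu]_(x in D) f x.
Proof.
move=> mf; rewrite -(setUv D) integral_setU//=; last 3 first.
- exact: measurableC.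
- by rewrite setUv.
- by apply/disj_set2P; rewrite setICr.
rewrite (@eq_measure_integral _ _ _ _ mu); last first.
  by move=> A mA AD; rewrite /= /mrestr setIidl.
rewrite [X in _ + X](@eq_measure_integral _ _ _ _ mzero); last first.
  by move=> A mA AD; rewrite /= /mrestr (disjoints_subset A D).2// measure0.
by rewrite integral_measure_zero adde0.
Qed.

Lemma integrable_measure_add (m1 m2 : {measure set T -> \bar R}) f :
  m1.-integrable setT f -> m2.-integrable setT f ->
  (measure_add m1 m2).-integrable setT f.
Proof.
move=> /integrableP[mf f1] /integrableP[_ f2]; apply/integrableP; split => //.
rewrite ge0_integral_measure_add//; first exact: lte_add_pinfty.
exact: measurableT_comp.
Qed.

Lemma integral_msum (m : {measure set T -> \bar R}^nat) f N :
  (forall k, (m k).-integrable setT f) ->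
  (msum m N).-integrable setT f /\
  \int[msum m N]_x f x = \sum_(k < N) \int[m k]_x f x.
Proof.
move=> mf; have msumS k : (msum m k.+1 : set T -> \bar R) = measure_add (msum m k) (m k).
  by apply/funext => A; rewrite measure_addE /msum/= big_ord_recr.
elim: N => [|N [IH1 IH2]].
  rewrite big_ord0 msum_mzero integral_measure_zero; split => //.
  have /integrableP[mf0 _] := mf 0%N.
  by apply/integrableP; split => //; rewrite integral_measure_zero.
have intE : (measure_add (msum m N) (m N)).-integrable setT f.
  exact: integrable_measure_add.
rewrite big_ord_recr/= -IH2; split.
  by rewrite msumS.
by rewrite msumS integral_measure_add//; have /integrableP[] := mf N.
Qed.

End measure_combinations.

(** * The surface integral as a sum over faces *)

Section surface_integral.
Context {R : realType} {n : nat} (a b : 'rV[R]_n.+1).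
Local Open Scope ereal_scope.

Let mins (i : 'I_n.+1) s : measurable_fun setT (@insert R n.+1 i s).
Proof. exact: (measurable_insert i (measurable_cst s) (@measurable_id _ _ _)). Qed.

Let restr (i : 'I_n.+1) : {measure set 'rV[R]_n -> \bar R} :=
  measure_function_mrestr__canonical__measure_function_Measure
    (lebesgue_rV n) (measurable_box (col' i a) (col' i b)).

Let face (i : 'I_n.+1) s : {measure set 'rV[R]_n.+1 -> \bar R} :=
  measure_function_pushforward__canonical__measure_function_Measure
    (restr i) (mins i s).

(** [msum] takes a sequence of measures indexed by all naturals, hence [inord]; only the indices
    below [n.+1] are summed. *)
Let faces (k : nat) : {measure set 'rV[R]_n.+1 -> \bar R} :=
  measure_add (face (inord k) (a ord0 (inord k))) (face (inord k) (b ord0 (inord k))).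

Let surface_msum A : measurable A -> surface a b A = msum faces n.+1 A.
Proof.
move=> mA; rewrite /surface /msum; apply: eq_bigr => i _.
rewrite [RHS]measure_addE inord_val big_cons big_seq1.
by congr (_ + _); rewrite /face/= /pushforward /restr/= /mrestr setIC.
Qed.

Lemma surface_finite : surface a b setT < +oo.
Proof.
rewrite surface_msum//; apply: lte_sum_pinfty => i _.
rewrite [ltLHS]measure_addE; apply: lte_add_pinfty;
  rewrite /face/= /pushforward /restr/= /mrestr preimage_setT setTI;
  exact: box_finite_measure.
Qed.

Let continuous_face i s (f : 'rV[R]_n.+1 -> R) : continuous f ->
  continuous (fun y => f (@insert R n.+1 i s y)).
Proof.
by move=> cf y; apply: continuous_comp; [exact: continuous_insert_snd|exact: cf].
Qed.

Let integrable_face i s (f : 'rV[R]_n.+1 -> R) : continuous f ->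
  (face i s).-integrable setT (EFin \o f).
Proof.
move=> cf.
apply: (integrable_pushforward (mins i s)) => //.
  by apply/measurable_EFinP; exact: continuous_measurable_rV.
have cf' : continuous (fun y : 'rV[R]_n => f (@insert R n.+1 i s y)).
  exact: continuous_face.
have /integrableP[_ foo] := integrable_box_continuous (col' i a) (col' i b) cf'.
apply/integrableP; split.
  by apply/measurable_EFinP; apply: measurable_funTS; exact: continuous_measurable_rV.
rewrite preimage_setT integral_mrestr//.
apply: measurableT_comp => //.
by apply/measurable_EFinP; exact: continuous_measurable_rV.
Qed.

Let integral_face i s (f : 'rV[R]_n.+1 -> R) : continuous f ->
  \int[face i s]_x (f x)%:E =
  \int[lebesgue_rV n]_(y in box (col' i a) (col' i b)) (f (@insert R n.+1 i s y))%:E.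
Proof.
move=> cf; have cf' : continuous (fun y : 'rV[R]_n => f (@insert R n.+1 i s y)).
  exact: continuous_face.
rewrite (integral_pushforward (mins i s))//.
- by rewrite preimage_setT integral_mrestr//; apply/measurable_EFinP;
    exact: continuous_measurable_rV.
- by apply/measurable_EFinP; exact: continuous_measurable_rV.
- have /integrableP[_ foo] := integrable_box_continuous (col' i a) (col' i b) cf'.
  apply/integrableP; split.
    by apply/measurable_EFinP; apply: measurable_funTS; exact: continuous_measurable_rV.
  rewrite preimage_setT integral_mrestr//.
  apply: measurableT_comp => //.
  by apply/measurable_EFinP; exact: continuous_measurable_rV.
Qed.

Let integrable_faces (f : 'rV[R]_n.+1 -> R) k : continuous f ->
  (faces k).-integrable setT (EFin \o f).
Proof.
by move=> cf; apply: integrable_measure_add; exact: integrable_face.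
Qed.

Lemma integrable_surface_continuous (f : 'rV[R]_n.+1 -> R) : continuous f ->
  (surface a b).-integrable setT (EFin \o f).
Proof.
move=> cf; have [/integrableP[mf foo] _] :=
  integral_msum n.+1 (fun k => integrable_faces k cf).
apply/integrableP; split => //.
rewrite (@eq_measure_integral _ _ _ _ (msum faces n.+1))//.
by move=> A mA _; exact: surface_msum.
Qed.

Lemma Rintegral_surface (f : 'rV[R]_n.+1 -> R) : continuous f ->
  (\int[surface a b]_x f x = \sum_(i < n.+1)
    (\int[lebesgue_rV n]_(y in box (col' i a) (col' i b)) f (@insert R n.+1 i (a ord0 i) y) +
     \int[lebesgue_rV n]_(y in box (col' i a) (col' i b)) f (@insert R n.+1 i (b ord0 i) y)))%R.
Proof.
move=> cf; rewrite {1}/Rintegral (@eq_measure_integral _ _ _ _ (msum faces n.+1)); last first.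
  by move=> A mA _; exact: surface_msum.
have [_ ->] := integral_msum n.+1 (fun k => integrable_faces k cf).
under eq_bigr => k _ do rewrite -(fineK (integrable_fin_num _ (integrable_faces k cf)))//.
rewrite sumEFin/=; apply: eq_bigr => i _; rewrite integral_measure_add//; last 2 first.
- exact: integrable_face.
- exact: integrable_face.
rewrite fineD; last 2 first.
- exact: integrable_fin_num (integrable_face _ _ cf).
- exact: integrable_fin_num (integrable_face _ _ cf).
by rewrite !integral_face// inord_val.
Qed.

End surface_integral.

(** * Square integrable functions on a set of finite measure *)

Section square_integrable_theory.
Context d (T : measurableType d) (R : realType) (mu : {measure set T -> \bar R}).
Variable D : set T.
Hypotheses (mD : measurable D) (muD : (mu D < +oo)%E).
Implicit Types (f g w : T -> R).

Lemma Rintegral_fsum (I : Type) (r : seq I) (f : I -> T -> R) :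
  (forall i, mu.-integrable D (EFin \o f i)) ->
  \int[mu]_(x in D) (\sum_(i <- r) f i x) =
  \sum_(i <- r) \int[mu]_(x in D) f i x.
Proof.
move=> intf; rewrite /Rintegral.
under eq_integral do rewrite -sumEFin.
rewrite (integral_sum mD intf).
by rewrite sum_fine// => i _; exact: integrable_fin_num (intf i).
Qed.

Lemma integrable_cst_dom (r : R) : mu.-integrable D (EFin \o cst r).
Proof.
apply: measurable_bounded_integrable => //.
by exists `|r|; split=> [|M rM x Dx /=]; [exact: num_real|exact: ltW].
Qed.

Lemma integrable_fD f g : mu.-integrable D (EFin \o f) ->
  mu.-integrable D (EFin \o g) -> mu.-integrable D (EFin \o (fun x => f x + g x)).
Proof. by move=> intf intg; exact: (integrableD mD intf intg). Qed.

Lemma integrable_fZ (r : R) f : mu.-integrable D (EFin \o f) ->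
  mu.-integrable D (EFin \o (fun x => r * f x)).
Proof. by move=> intf; exact: (integrableZl mD r intf). Qed.

(** The product is dominated by [M * (1 + f ^+ 2)], which is integrable because [mu D] is finite. *)
Lemma integrable_sqM f w (M : R) : square_integrable mu D f ->
  measurable_fun D w -> (forall x, D x -> `|w x| <= M) ->
  mu.-integrable D (fun x => (f x * w x)%:E).
Proof.
move=> [mf sqf] mw wM.
apply: (@le_integrable _ _ _ mu D mD _ (fun x => (M * (1 + f x ^+ 2))%:E)).
- by apply/measurable_EFinP; exact: measurable_funM.
- move=> x Dx; rewrite !abse_EFin lee_fin normrM [leRHS]ger0_norm; last first.
    by rewrite mulr_ge0 ?addr_ge0 ?sqr_ge0// (le_trans _ (wM x Dx)).
  rewrite mulrC; apply: ler_pM => //; first exact: wM.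
  rewrite -[f x ^+ 2]real_normK ?num_real//.
  have := sqr_ge0 (`|f x| - 1); rewrite sqrrB expr1n mulr1.
  have := normr_ge0 (f x); move: (`|f x|) => y; nra.
- have -> : (fun x => (M * (1 + f x ^+ 2))%:E) =
      (fun x => M%:E * ((cst 1%:E \+ (fun x => (f x ^+ 2)%:E)) x))%E.
    by apply/funext => x; rewrite EFinM EFinD.
  apply: integrableZl => //; apply: integrableD => //.
  exact: integrable_cst_dom.
Qed.

Lemma integrable_sq f : square_integrable mu D f ->
  mu.-integrable D (EFin \o f).
Proof.
move=> sqf.
have := @integrable_sqM f (cst 1) 1 sqf (measurable_cst _) _.
rewrite (_ : (fun x => _) = EFin \o f); last by apply/funext => x /=; rewrite mulr1.
by apply => x _; rewrite normr1.
Qed.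

Lemma square_integrableB f g : square_integrable mu D f ->
  square_integrable mu D g -> square_integrable mu D (fun x => f x - g x).
Proof.
move=> [mf sf] [mg sg]; split; first exact: measurable_funB.
apply: (@le_integrable _ _ _ mu D mD _
  (fun x => (2%:E * (f x ^+ 2)%:E + 2%:E * (g x ^+ 2)%:E)%E)).
- apply/measurable_EFinP; apply: measurable_funX; exact: measurable_funB.
- move=> x Dx; rewrite -!EFinM -EFinD !abse_EFin lee_fin !ger0_norm ?sqr_ge0//.
    by have := sqr_ge0 (f x + g x); nra.
  by rewrite addr_ge0// mulr_ge0// sqr_ge0.
- by apply: integrableD => //; exact: integrableZl.
Qed.

Lemma cvg_Rintegral_dominated f (w_ : nat -> T -> R) w (M : R) :
  square_integrable mu D f ->
  (forall k, measurable_fun D (w_ k)) -> measurable_fun D w ->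
  (forall k x, D x -> `|w_ k x| <= M) ->
  (forall x, D x -> w_ k x @[k --> \oo] --> w x) ->
  (\int[mu]_(x in D) (f x * w_ k x)) @[k --> \oo] -->
  \int[mu]_(x in D) (f x * w x).
Proof.
move=> sqf mw_ mw wM w_w; have [mf _] := sqf.
have intf := integrable_sq sqf.
have [] := @dominated_convergence _ _ _ mu D mD
  (fun k x => (f x * w_ k x)%:E) (fun x => (f x * w x)%:E)
  (fun x => (M%:E * `|(f x)%:E|)%E).
- by move=> k; apply/measurable_EFinP; exact: measurable_funM.
- by apply/measurable_EFinP; exact: measurable_funM.
- apply: aeW => x Dx; apply: cvg_EFin; first exact: nearW.
  by apply: cvgM; [exact: cvg_cst|exact: w_w].
- by apply: integrableZl => //; exact: integrable_abse.
- apply: aeW => x k Dx; rewrite !abse_EFin -EFinM lee_fin normrM mulrC.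
  by rewrite ler_wpM2r// wM.
move=> intfw _ cvgI.
by apply: fine_cvg; rewrite fineK//; exact: integrable_fin_num.
Qed.

(** Young's inequality [y <= de + y^2 / (4 * de)], applied to [y = |f_ k - f|], bounds the integral
    of [y] by a small multiple of [mu D] plus a large multiple of the squared L^2 distance, which
    tends to 0. *)
Lemma cvg_Rintegral_L2 (f_ : nat -> T -> R) f w (M : R) :
  (forall k, square_integrable mu D (f_ k)) -> square_integrable mu D f ->
  measurable_fun D w -> (forall x, D x -> `|w x| <= M) ->
  (\int[mu]_(x in D) ((f_ k x - f x) ^+ 2)) @[k --> \oo] --> (0 : R) ->
  (\int[mu]_(x in D) (f_ k x * w x)) @[k --> \oo] -->
  \int[mu]_(x in D) (f x * w x).
Proof.
move=> sf_ sf mw wM L2.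
set N := `|M| + 1; set V := fine (mu D).
have N0 : 0 < N by rewrite ltr_wpDl.
have V0 : 0 <= V by rewrite fine_ge0.
have int1 k : mu.-integrable D (fun x => ((f_ k x - f x) * w x)%:E).
  exact: integrable_sqM (square_integrableB (sf_ k) sf) mw wM.
have intsq k : mu.-integrable D (EFin \o (fun x => (f_ k x - f x) ^+ 2)).
  by have [] := square_integrableB (sf_ k) sf.
have bound k (de : R) : 0 < de -> `|\int[mu]_(x in D) ((f_ k x - f x) * w x)| <=
    N * (de * V + (4 * de)^-1 * \int[mu]_(x in D) ((f_ k x - f x) ^+ 2)).
  move=> de0; apply: le_trans (le_normr_Rintegral mD (int1 k)) _.
  have intZ : mu.-integrable D (EFin \o (fun x => (4 * de)^-1 * (f_ k x - f x) ^+ 2)).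
    exact: integrable_fZ.
  have intD : mu.-integrable D (EFin \o (fun x => de + (4 * de)^-1 * (f_ k x - f x) ^+ 2)).
    by apply: integrable_fD => //; exact: integrable_cst_dom.
  have -> : N * (de * V + (4 * de)^-1 * \int[mu]_(x in D) ((f_ k x - f x) ^+ 2)) =
      \int[mu]_(x in D) (N * (de + (4 * de)^-1 * (f_ k x - f x) ^+ 2)).
    rewrite RintegralZl; [|exact: mD|exact: intD].
    rewrite RintegralD; [|exact: mD|exact: integrable_cst_dom|exact: intZ].
    by rewrite Rintegral_cst// RintegralZl.
  apply: le_Rintegral => //.
  - exact: (integrable_norm (int1 k)).
  - exact: integrable_fZ.
  - move=> x Dx; rewrite normrM mulrC; apply: ler_pM => //.
      by rewrite /N (le_trans (wM x Dx))// (le_trans (ler_norm _))// lerDl.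
    rewrite -[X in _ <= de + _ * X]real_normK ?num_real//.
    move: (`|f_ k x - f x|) => y.
    rewrite -subr_ge0 (_ : _ - y = (y - 2 * de) ^+ 2 / (4 * de)).
      by rewrite mulr_ge0 ?sqr_ge0// invr_ge0 mulr_ge0// ltW.
    by field; exact: lt0r_neq0.
have diff0 : (\int[mu]_(x in D) ((f_ k x - f x) * w x)) @[k --> \oo] --> (0 : R).
  apply/cvgr0Pnorm_le => /= e e0.
  have VV : 0 < V + 1 by rewrite ltr_wpDl.
  (* This [de] makes [N * de * V] at most [e / 2], with [V + 1] in the denominator in case [V] is 0.
     The level [4 * de * (e / (2 * N))] imposed on the squared distance makes the second part at
     most [e / 2]. *)
  have [de de0 deE] : exists2 de : R, 0 < de & de = e / (2 * N * (V + 1)).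
    eexists; last reflexivity.
    by apply: divr_gt0 => //; do 2 apply: mulr_gt0 => //.
  have eta0 : 0 < 4 * de * (e / (2 * N)).
    by apply: mulr_gt0; [exact: mulr_gt0|apply: divr_gt0 => //; exact: mulr_gt0].
  near=> k.
  apply: (le_trans (bound k de de0)).
  have : \int[mu]_(x in D) ((f_ k x - f x) ^+ 2) <= 4 * de * (e / (2 * N)).
    by near: k; exact: cvgr_le L2 _ eta0.
  rewrite -ler_pdivrMl ?mulr_gt0// => h.
  have -> : e = N * (e / (2 * N) + e / (2 * N)) by field; exact: lt0r_neq0.
  rewrite ler_pM2l// lerD//.
  rewrite deE mulrAC ler_pdivrMr ?mulr_gt0// mulrAC mulrA.
  rewrite ler_pdivlMr ?mulr_gt0//.
  have Ne : 0 <= e * (2 * N) by rewrite !mulr_ge0// ltW.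
  nra.
have -> : (fun k => \int[mu]_(x in D) (f_ k x * w x)) =
    (fun k => \int[mu]_(x in D) ((f_ k x - f x) * w x) + \int[mu]_(x in D) (f x * w x)).
  apply/funext => k.
  rewrite -RintegralD; [|exact: mD|exact: int1|exact: integrable_sqM sf mw wM].
  by apply: eq_Rintegral => x _; ring.
have := cvgD diff0 (cvg_cst (\int[mu]_(x in D) (f x * w x))).
by rewrite add0r; exact.
Unshelve. all: by end_near. Qed.

End square_integrable_theory.

(** * H^1 functions on a box: cutoffs, integration by parts, traces *)

Section sobolev_box.
Context {R : realType} {n : nat} (a b : 'rV[R]_n.+1).
Hypothesis ab : forall i, a ord0 i < b ord0 i.
Local Notation Rn := 'rV[R]_n.+1.
Local Notation leb := (lebesgue_rV n.+1).
Local Notation Omega := (box a b).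
Implicit Types (u v phi psi : Rn -> R) (g h : 'I_n.+1 -> Rn -> R) (x : Rn).

Let mOmega : measurable Omega. Proof. exact: measurable_box. Qed.

Let Omega_fin : (leb Omega < +oo)%E. Proof. exact: (@box_finite_measure R n.+1). Qed.

Lemma continuousM_fun phi psi : continuous phi -> continuous psi ->
  continuous (fun x => phi x * psi x).
Proof. by move=> cp cq x; exact: continuousM (cp x) (cq x). Qed.

Lemma square_integrable_continuous phi : continuous phi ->
  square_integrable leb Omega phi.
Proof.
move=> cphi; split; first by apply: measurable_funTS; exact: continuous_measurable_rV.
by apply: (@integrable_box_continuous _ _ a b (fun x => phi x ^+ 2)); exact: continuousM_fun.
Qed.

Lemma square_integrable_surface phi : continuous phi ->
  square_integrable (surface a b) setT phi.
Proof.
move=> cphi; split; first exact: continuous_measurable_rV.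
apply: (@integrable_surface_continuous _ _ a b (fun x => phi x ^+ 2)).
exact: continuousM_fun.
Qed.

Lemma continuous_bounded_box phi : continuous phi ->
  exists M, forall x, Omega x -> `|phi x| <= M.
Proof.
move=> cphi; have [M _ HM] := continuous_bounded_closed_box a b cphi.
by exists M => x /box_closed; exact: HM.
Qed.

Lemma Rintegral_partial0 psi (i : 'I_n.+1) : smooth psi ->
  (forall x, x ord0 i = a ord0 i \/ x ord0 i = b ord0 i -> psi x = 0) ->
  \int[leb]_(x in Omega) partial i psi x = 0.
Proof.
move=> Spsi psi0; rewrite (Rintegral_partial (ab i) Spsi).
have H s : s = a ord0 i \/ s = b ord0 i ->
    \int[lebesgue_rV n]_(y in box (col' i a) (col' i b)) psi (@insert R n.+1 i s y) = 0.
  move=> si; rewrite (@eq_Rintegral _ _ _ _ _ (cst 0)) => [|y _]; last first.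
    by rewrite psi0// insertE.
  by rewrite Rintegral_cst ?mul0r//; exact: measurable_box.
by rewrite !H ?subrr//; [left|right].
Qed.

(** Only the two faces orthogonal to the [i]-th axis produce a boundary term, so [psi] has to vanish
    on these alone. *)
Lemma Rintegral_by_parts phi psi (i : 'I_n.+1) : smooth phi -> smooth psi ->
  (forall x, x ord0 i = a ord0 i \/ x ord0 i = b ord0 i -> psi x = 0) ->
  \int[leb]_(x in Omega) (phi x * partial i psi x) =
  - \int[leb]_(x in Omega) (partial i phi x * psi x).
Proof.
move=> Sphi Spsi psi0.
have cphi := smooth_continuous Sphi; have cpsi := smooth_continuous Spsi.
have cdphi := smooth_continuous (smooth_partial i Sphi).
have cdpsi := smooth_continuous (smooth_partial i Spsi).
have := Rintegral_partial0 (smoothM Sphi Spsi) (i := i).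
under eq_Rintegral => x _ do rewrite partialM//.
rewrite RintegralD//; last 2 first.
- exact/(@integrable_box_continuous _ n.+1)/continuousM_fun.
- exact/(@integrable_box_continuous _ n.+1)/continuousM_fun.
under [X in _ -> _ = - X]eq_Rintegral => x _ do rewrite mulrC.
move=> /(_ _)/eqP; rewrite addr_eq0 => H; apply/eqP; apply: H => x xi.
by rewrite /= psi0// mulr0.
Qed.

Lemma test_function_boundary phi x (i : 'I_n.+1) : test_function Omega phi ->
  x ord0 i = a ord0 i \/ x ord0 i = b ord0 i -> phi x = 0.
Proof.
move=> [_ [K [_ KO K0]]] xi; apply: K0 => /KO /(_ i).
by case: xi => ->; rewrite ltxx ?andbF.
Qed.

Lemma H1_smooth phi : smooth phi -> H1 Omega phi (fun i => partial i phi).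
Proof.
move=> Sphi; split.
- exact/square_integrable_continuous/smooth_continuous.
- by move=> i; exact/square_integrable_continuous/smooth_continuous/smooth_partial.
- move=> th i Tth; apply: Rintegral_by_parts => //; first by case: Tth.
  by move=> x; exact: test_function_boundary.
Qed.

Lemma is_trace_smooth phi : smooth phi ->
  is_trace a b phi (fun i => partial i phi) phi.
Proof.
move=> Sphi; split; first exact/square_integrable_surface/smooth_continuous.
exists (fun=> phi); split => //.
- under eq_fun do under eq_Rintegral do rewrite subrr expr0n.
  by rewrite Rintegral_cst// mul0r; exact: cvg_cst.
- move=> i; under eq_fun do under eq_Rintegral do rewrite subrr expr0n.
  by rewrite Rintegral_cst// mul0r; exact: cvg_cst.
- under eq_fun do under eq_Rintegral do rewrite subrr expr0n.
  by rewrite Rintegral_cst// mul0r; exact: cvg_cst.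
Qed.

Definition box_cutoff k x : R := \prod_j cutoff (a ord0 j) (b ord0 j) k (x ord0 j).

Definition box_cutoff' (i : 'I_n.+1) k x : R :=
  \prod_(j | j != i) cutoff (a ord0 j) (b ord0 j) k (x ord0 j).

Lemma smooth_box_cutoff k : smooth (box_cutoff k).
Proof. by apply: smooth_prod => j; exact: smooth_cutoff. Qed.

Lemma partial_box_cutoff i k x : partial i (box_cutoff k) x =
  dcutoff (a ord0 i) (b ord0 i) k (x ord0 i) * box_cutoff' i k x.
Proof.
have [] // := @is_derive_line _ _ i (box_cutoff k)
  (fun s => cutoff (a ord0 i) (b ord0 i) k s * box_cutoff' i k x) x
  (dcutoff (a ord0 i) (b ord0 i) k (x ord0 i) * box_cutoff' i k x).
- move=> h; rewrite /box_cutoff (bigD1 i)//= !mxE !eqxx/= mulr1; congr (_ * _).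
  apply: eq_bigr => j ji; congr cutoff.
  by rewrite !mxE (negbTE ji)/= ?andbF mulr0 add0r.
- have h := is_derive_cutoff (a ord0 i) (b ord0 i) k (x ord0 i).
  by apply: is_derive_eq; rewrite /GRing.scale/=; ring.
Qed.

Lemma box_cutoff01 (P : pred 'I_n.+1) k x :
  0 <= \prod_(j | P j) cutoff (a ord0 j) (b ord0 j) k (x ord0 j) <= 1.
Proof.
apply: (big_ind (fun r : R => 0 <= r <= 1)) => [|r s /andP[r0 r1] /andP[s0 s1]|j _].
- by rewrite ler01 lexx.
- by rewrite mulr_ge0//= mulr_ile1.
- by rewrite cutoff_ge0 cutoff_le1.
Qed.

Lemma cvg_box_cutoff (P : pred 'I_n.+1) x : Omega x ->
  (\prod_(j | P j) cutoff (a ord0 j) (b ord0 j) k (x ord0 j)) @[k --> \oo] --> (1 : R).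
Proof.
move=> Ox; elim: (index_enum _) => [|j r IH].
  by under eq_fun do rewrite big_nil; exact: cvg_cst.
under eq_fun do rewrite big_cons; case: (P j) => //.
by have := cvgM (cvg_cutoff (Ox j)) IH; rewrite mulr1; exact.
Qed.

Lemma test_function_cutoff psi k : smooth psi ->
  test_function Omega (fun x => psi x * box_cutoff k x).
Proof.
move=> Spsi; split; first exact: smoothM Spsi (smooth_box_cutoff k).
exists [set x : Rn | forall i, (\row_j (a ord0 j + k.+1%:R^-1)) ord0 i <= x ord0 i
  <= (\row_j (b ord0 j - k.+1%:R^-1)) ord0 i].
split; first exact: closed_box_compact.
- move=> x Kx i; have := Kx i; rewrite !mxE => /andP[ax xb].
  have k0 : 0 < k.+1%:R^-1 :> R by rewrite invr_gt0.
  by rewrite (lt_le_trans _ ax) ?ltrDl// (le_lt_trans xb)// ltrBlDr ltrDl.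
- move=> x Kx; have [j cj] : exists j, cutoff (a ord0 j) (b ord0 j) k (x ord0 j) = 0.
    apply: contrapT => nex; apply: Kx => j; rewrite !mxE; apply: cutoff_supp.
    by apply/eqP => cj; apply: nex; exists j.
  by rewrite /box_cutoff (bigD1 j)//= cj mul0r mulr0.
Qed.

Lemma measurable_smooth phi (D : set Rn) : smooth phi -> measurable_fun D phi.
Proof.
move=> Sphi; apply: measurable_funTS; apply: continuous_measurable_rV.
exact: smooth_continuous.
Qed.

(* Green's formula without boundary term, although [u] need not vanish on the
   boundary: only the normal component [psi] of the test field does. *)
Lemma H1_by_parts u g psi (i : 'I_n.+1) (C : R) : H1 Omega u g -> smooth psi ->
  (forall x, Omega x -> `|psi x| <= C * (x ord0 i - a ord0 i) /\
                        `|psi x| <= C * (b ord0 i - x ord0 i)) ->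
  \int[leb]_(x in Omega) (u x * partial i psi x) =
  - \int[leb]_(x in Omega) (g i x * psi x).
Proof.
move=> [su sg ug] Spsi psiC.
have Sdpsi := smooth_partial i Spsi.
have [M psiM] := continuous_bounded_box (smooth_continuous Spsi).
have [N dpsiN] := continuous_bounded_box (smooth_continuous Sdpsi).
(* [psi * box_cutoff k] is an admissible test function. Its [i]-th derivative is dominated by
   [6 * C + N]: [6 * C] when the derivative falls on the cutoff, [N] when it falls on [psi]. *)
have L : (\int[leb]_(x in Omega)
      (u x * partial i (fun x => psi x * box_cutoff k x) x)) @[k --> \oo] -->
    \int[leb]_(x in Omega) (u x * partial i psi x).
  apply: (@cvg_Rintegral_dominated _ _ _ leb _ _ _ u
    (fun k => partial i (fun x => psi x * box_cutoff k x)) _ (6 * C + N)) => //.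
  - move=> k; apply: measurable_smooth; apply: smooth_partial.
    exact: smoothM Spsi (smooth_box_cutoff k).
  - exact: measurable_smooth.
  - move=> k x Ox; rewrite (partialM _ _ Spsi (smooth_box_cutoff k)) partial_box_cutoff.
    have /andP[c0 c1] := box_cutoff01 predT k x.
    have /andP[c'0 c'1] := box_cutoff01 (fun j => j != i) k x.
    rewrite (le_trans (ler_normD _ _))// lerD//.
      rewrite mulrA normrM -[leRHS]mulr1 ler_pM// ?(ger0_norm c'0)//.
      have [h1 h2] := psiC x Ox.
      exact: dcutoff_bound.
    rewrite normrM -[leRHS]mul1r ler_pM// ?(ger0_norm c0)//; exact: dpsiN.
  - move=> x Ox.
    under eq_fun do rewrite (partialM _ _ Spsi (smooth_box_cutoff _)) partial_box_cutoff mulrA.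
    have h1 : (psi x * dcutoff (a ord0 i) (b ord0 i) k (x ord0 i) * box_cutoff' i k x)
        @[k --> \oo] --> (0 * 1 : R).
      by apply: cvgM; [exact: cvg_dcutoff|exact: cvg_box_cutoff].
    have h2 : (box_cutoff k x * partial i psi x) @[k --> \oo] --> 1 * partial i psi x.
      by apply: cvgM; [exact: cvg_box_cutoff|exact: cvg_cst].
    by have := cvgD h1 h2; rewrite mul0r add0r mul1r; exact.
have Rr : (\int[leb]_(x in Omega) (g i x * (psi x * box_cutoff k x))) @[k --> \oo] -->
    \int[leb]_(x in Omega) (g i x * psi x).
  apply: (@cvg_Rintegral_dominated _ _ _ leb _ _ _ (g i)
    (fun k => fun x => psi x * box_cutoff k x) _ M) => //.
  - by move=> k; apply: measurable_smooth; exact: smoothM Spsi (smooth_box_cutoff k).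
  - exact: measurable_smooth.
  - move=> k x Ox; have /andP[c0 c1] := box_cutoff01 predT k x.
    rewrite normrM -[leRHS]mulr1 ler_pM// ?(ger0_norm c0)//; exact: psiM.
  - move=> x Ox; have hx : (psi x * box_cutoff k x) @[k --> \oo] --> psi x * 1.
      by apply: cvgM; [exact: cvg_cst|exact: cvg_box_cutoff].
    by rewrite mulr1 in hx.
have E k : \int[leb]_(x in Omega) (u x * partial i (fun x => psi x * box_cutoff k x) x) =
    - \int[leb]_(x in Omega) (g i x * (psi x * box_cutoff k x)).
  by apply: ug; exact: test_function_cutoff.
rewrite (funext E) in L.
by apply: (cvg_unique _ L (cvgN Rr)).
Qed.

(** [weak_solution] and [boundary_value] each provide their own weak gradient, and the two have to
    be exchanged under the integral. Cutoffs make [psi] a test function, and dominated convergence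
    removes them. *)
Lemma weak_gradient_unique u g h psi (i : 'I_n.+1) :
  H1 Omega u g -> H1 Omega u h -> smooth psi ->
  \int[leb]_(x in Omega) (g i x * psi x) = \int[leb]_(x in Omega) (h i x * psi x).
Proof.
move=> [_ sg ug] [_ sh uh] Spsi.
have [M psiM] := continuous_bounded_box (smooth_continuous Spsi).
have L f : square_integrable leb Omega f ->
    (\int[leb]_(x in Omega) (f x * (psi x * box_cutoff k x))) @[k --> \oo] -->
    \int[leb]_(x in Omega) (f x * psi x).
  move=> sf; apply: (@cvg_Rintegral_dominated _ _ _ leb _ _ _ f
    (fun k => fun x => psi x * box_cutoff k x) _ M) => //.
  - by move=> k; apply: measurable_smooth; exact: smoothM Spsi (smooth_box_cutoff k).
  - exact: measurable_smooth.
  - move=> k x Ox; have /andP[c0 c1] := box_cutoff01 predT k x.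
    rewrite normrM -[leRHS]mulr1 ler_pM// ?(ger0_norm c0)//; exact: psiM.
  - move=> x Ox; have hx : (psi x * box_cutoff k x) @[k --> \oo] --> psi x * 1.
      by apply: cvgM; [exact: cvg_cst|exact: cvg_box_cutoff].
    by rewrite mulr1 in hx.
apply: (cvg_unique _ (L _ (sg i)) _) => //.
suff -> : (fun k => \int[leb]_(x in Omega) (g i x * (psi x * box_cutoff k x))) =
   (fun k => \int[leb]_(x in Omega) (h i x * (psi x * box_cutoff k x))) by exact: L.
apply/funext => k; apply: oppr_inj.
by rewrite -ug ?uh//; exact: test_function_cutoff.
Qed.

End sobolev_box.

(** * Powers of a cosine and their first two derivatives *)

Section cosine_powers.
Context {R : realType} (al be : R).
Implicit Types (m : nat) (s : R).

Definition cosp (m : nat) (s : R) : R := cos (al * s + be) ^+ m.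

Definition dcosp (m : nat) (s : R) : R :=
  - (m%:R * al) * (sin (al * s + be) * cosp m.-1 s).

(** The squared sine is rewritten as 1 minus the squared cosine, so the second derivative is again a
    combination of powers of the cosine. For [m <= 1] the truncated exponent [m.-2] is harmless, its
    coefficient being 0. *)
Definition ddcosp (m : nat) (s : R) : R :=
  al ^+ 2 * ((m * m.-1)%:R * cosp m.-2 s - m%:R ^+ 2 * cosp m s).

Lemma is_derive_cosp1 s :
  is_derive s 1 (fun s => cos (al * s + be)) (- al * sin (al * s + be)).
Proof.
have h := is_derive_affine al be s.
have hc : is_derive s 1 (cos \o (fun s => al * s + be)) (- sin (al * s + be) * al).
  exact: is_derive1_comp.
by apply: is_derive_eq; ring.
Qed.

Lemma is_derive_sinp1 s :
  is_derive s 1 (fun s => sin (al * s + be)) (al * cos (al * s + be)).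
Proof.
have h := is_derive_affine al be s.
have hc : is_derive s 1 (sin \o (fun s => al * s + be)) (cos (al * s + be) * al).
  exact: is_derive1_comp.
by apply: is_derive_eq; ring.
Qed.

Lemma is_derive_cosp m s : is_derive s 1 (cosp m) (dcosp m s).
Proof.
elim: m => [|m IH].
  rewrite (_ : cosp 0 = cst 1); last by apply/funext => x; rewrite /cosp expr0.
  by apply: is_derive_eq; rewrite /dcosp !mul0r oppr0 mul0r.
rewrite (_ : cosp m.+1 = fun s => cos (al * s + be) * cosp m s); last first.
  by apply/funext => x; rewrite /cosp exprS.
have h := is_derive_cosp1 s.
apply: is_derive_eq; rewrite /GRing.scale/= /dcosp/=.
case: m {IH} => [|m]; first by rewrite /cosp expr0; ring.
rewrite /= (_ : cosp m.+1 s = cos (al * s + be) * cosp m s); last by rewrite /cosp exprS.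
by rewrite -[m.+2%:R]natr1; ring.
Qed.

Lemma is_derive_dcosp m s : is_derive s 1 (dcosp m) (ddcosp m s).
Proof.
have h := is_derive_sinp1 s; have h' := is_derive_cosp m.-1 s.
apply: is_derive_eq; rewrite /GRing.scale/= /ddcosp /dcosp.
case: m {h'} => [|[|m]] /=.
- by rewrite muln0; ring.
- by rewrite /cosp muln0 expr0 expr1; ring.
- have c1 : cosp m.+1 s = cos (al * s + be) * cosp m s by rewrite /cosp exprS.
  have c2 : cosp m.+2 s = cos (al * s + be) ^+ 2 * cosp m s by rewrite /cosp -exprD.
  have s2 := sin2cos2 (al * s + be).
  rewrite c1 c2 natrM -[m.+2%:R]natr1.
  have -> : sin (al * s + be) * (- (m.+1%:R * al) * (sin (al * s + be) * cosp m s)) =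
    - (m.+1%:R * al) * (cosp m s * sin (al * s + be) ^+ 2) by ring.
  rewrite s2.
  by ring.
Qed.

End cosine_powers.

(** * Products of cosine powers satisfying the Neumann condition *)

Section neumann_modes.
Context {R : realType} {n : nat} (a b : 'rV[R]_n.+1).
Hypothesis ab : forall i, a ord0 i < b ord0 i.
Local Notation Rn := 'rV[R]_n.+1.
Local Notation leb := (lebesgue_rV n.+1).
Local Notation Omega := (box a b).
Implicit Types (u v phi psi : Rn -> R) (g h : 'I_n.+1 -> Rn -> R) (x : Rn).
Implicit Types (j : 'I_n.+1 -> nat).

Definition freq i : R := pi / (b ord0 i - a ord0 i).

(** With this phase the angle is [freq i * (x_i - a_i)]: it runs from 0 to pi across the box, and
    its sine vanishes on both faces. *)
Definition phase i : R := - (freq i * a ord0 i).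

Lemma freqE i : freq i * (b ord0 i - a ord0 i) = pi.
Proof. by rewrite /freq divfK// gt_eqF// subr_gt0. Qed.

Lemma freq_gt0 i : 0 < freq i.
Proof. by rewrite divr_gt0 ?pi_gt0// subr_gt0. Qed.

(* Powers of cosines, instead of cosines of multiples, so that the integrals
   against modes determine those against polynomials in the cosines. *)
Definition mode j x : R := \prod_i cosp (freq i) (phase i) (j i) (x ord0 i).

Definition mode' i j x : R :=
  \prod_(l | l != i) cosp (freq l) (phase l) (j l) (x ord0 l).

Lemma modeD1 i j x :
  mode j x = cosp (freq i) (phase i) (j i) (x ord0 i) * mode' i j x.
Proof. by rewrite /mode (bigD1 i). Qed.

Lemma mode'_indep i j (h : R) x : mode' i j (h *: delta_mx ord0 i + x) = mode' i j x.
Proof.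
apply: eq_bigr => l li; congr cosp.
by rewrite !mxE (negbTE li)/= ?andbF mulr0 add0r.
Qed.

Lemma smooth_cos (al be : R) i : smooth (fun x : Rn => cos (al * x ord0 i + be)).
Proof.
rewrite (_ : (fun x : Rn => _) =
  fun x : Rn => 1 * cos (al * x ord0 i + be) + 0 * sin (al * x ord0 i + be)).
  exact: smooth_trig.
by apply/funext => x; rewrite mul1r mul0r addr0.
Qed.

Lemma smooth_mode j : smooth (mode j).
Proof.
apply: smooth_prod => i; elim: (j i) => [|m IH].
  by rewrite (_ : (fun x : Rn => _) = cst 1)//; exact: smooth_cst.
rewrite (_ : (fun x : Rn => _) = (fun x : Rn => cos (freq i * x ord0 i + phase i)) \*
  (fun x : Rn => cosp (freq i) (phase i) m (x ord0 i))).
  exact: smoothM (smooth_cos _ _ _) IH.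
by apply/funext => x; rewrite /cosp exprS.
Qed.

Lemma partial_mode_gen i j (f df : R -> R) :
  (forall s : R, is_derive s 1 f (df s)) ->
  partial i (fun x => f (x ord0 i) * mode' i j x) =
  fun x => df (x ord0 i) * mode' i j x.
Proof.
move=> fdf; apply/funext => x.
have [] // := @is_derive_line _ _ i (fun x => f (x ord0 i) * mode' i j x)
  (fun s => f s * mode' i j x) x (df (x ord0 i) * mode' i j x).
- by move=> h; rewrite mode'_indep !mxE !eqxx/= mulr1.
- have h := fdf (x ord0 i).
  by apply: is_derive_eq; rewrite /GRing.scale/=; ring.
Qed.

Lemma partial_mode i j : partial i (mode j) =
  fun x => dcosp (freq i) (phase i) (j i) (x ord0 i) * mode' i j x.
Proof.
rewrite (_ : mode j = fun x => cosp (freq i) (phase i) (j i) (x ord0 i) * mode' i j x).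
  by apply: partial_mode_gen => s; exact: is_derive_cosp.
by apply/funext => x; exact: modeD1.
Qed.

Definition drop2 i j l : nat := if l == i then (j l).-2 else j l.

Lemma partial2_mode i j : partial i (partial i (mode j)) =
  fun x => freq i ^+ 2 * ((j i * (j i).-1)%:R * mode (drop2 i j) x -
                          (j i)%:R ^+ 2 * mode j x).
Proof.
rewrite partial_mode (partial_mode_gen _ _ (is_derive_dcosp _ _ _)).
apply/funext => x; rewrite (modeD1 i (drop2 i j)) (modeD1 i j) /ddcosp.
rewrite {1}/drop2 eqxx (_ : mode' i (drop2 i j) x = mode' i j x); first ring.
by apply: eq_bigr => l li; rewrite /drop2 (negbTE li).
Qed.

Lemma sin_le (s : R) : 0 <= s -> sin s <= s.
Proof.
rewrite le_eqVlt => /predU1P[<-|s0]; first by rewrite sin0.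
have [|c _] := @MVT R sin cos 0 s s0.
  by apply: continuous_subspaceT; exact: continuous_sin.
rewrite sin0 !subr0 => ->.
by rewrite -[leRHS]mul1r ler_wpM2r// ?cos_le1// ltW.
Qed.

(** The bound at the face [b] follows from the one at [a] by the symmetry of the sine about pi / 2.
    These are the linear bounds that [H1_by_parts] asks for. *)
Lemma sin_phase i x : Omega x -> let s := sin (freq i * x ord0 i + phase i) in
  [/\ 0 <= s, s <= freq i * (x ord0 i - a ord0 i) &
      s <= freq i * (b ord0 i - x ord0 i)].
Proof.
move=> /(_ i) /andP[ax xb] /=.
have E1 : freq i * x ord0 i + phase i = freq i * (x ord0 i - a ord0 i).
  by rewrite /phase; ring.
have E2 : freq i * (x ord0 i - a ord0 i) = pi - freq i * (b ord0 i - x ord0 i).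
  have := freqE i.
  by move: (pi : R) => p; lra.
have p1 : 0 <= freq i * (x ord0 i - a ord0 i).
  by rewrite mulr_ge0 ?subr_ge0// ?ltW ?freq_gt0.
have p2 : 0 <= freq i * (b ord0 i - x ord0 i).
  by rewrite mulr_ge0 ?subr_ge0// ?ltW ?freq_gt0.
rewrite E1; split; last 2 first.
- exact: sin_le.
- rewrite E2 sinB sinpi cospi mul0r sub0r mulN1r opprK.
  exact: sin_le.
- by apply: sin_ge0_pi; rewrite p1 E2 gerBl.
Qed.

Lemma mode'_le1 i j x : `|mode' i j x| <= 1.
Proof.
rewrite /mode'; apply: (big_ind (fun r : R => `|r| <= 1)) => [|r s r1 s1|l _].
- by rewrite normr1.
- by rewrite normrM mulr_ile1.
- by rewrite /cosp normrX exprn_ile1// cos_max.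
Qed.

Lemma partial_mode_bound i j : exists C, forall x, Omega x ->
  `|partial i (mode j) x| <= C * (x ord0 i - a ord0 i) /\
  `|partial i (mode j) x| <= C * (b ord0 i - x ord0 i).
Proof.
(* One factor [freq i] comes from the derivative, the other from bounding the sine by [freq i] times
   the distance to the face. *)
exists ((j i)%:R * freq i * freq i) => x Ox; rewrite partial_mode.
have [s0 sa sb] := sin_phase i Ox.
have f0 : 0 <= freq i by rewrite ltW// freq_gt0.
have H : `|dcosp (freq i) (phase i) (j i) (x ord0 i) * mode' i j x| <=
    (j i)%:R * freq i * sin (freq i * x ord0 i + phase i).
  rewrite /dcosp normrM -[leRHS]mulr1 ler_pM// ?mode'_le1//.
  have jf0 : 0 <= (j i)%:R * freq i by exact: mulr_ge0.
  rewrite normrM normrN (ger0_norm jf0); apply: ler_wpM2l => //.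
  rewrite normrM (ger0_norm s0) -[leRHS]mulr1 ler_pM//.
  by rewrite /cosp normrX exprn_ile1// cos_max.
by split; apply: (le_trans H); rewrite -mulrA -mulrA -mulrA ler_wpM2l// ler_wpM2l.
Qed.

End neumann_modes.

Lemma box_not_negligible {R : realType} {n : nat} (c d : 'rV[R]_n) :
  (forall i, c ord0 i < d ord0 i) -> ~ (lebesgue_rV n).-negligible (box c d).
Proof.
move=> cd /(measure_negligible (measurable_box c d)) B0.
have : lebesgue_rV n (box c d) = 0%E by exact: B0.
rewrite lebesgue_rV_box => [[]/eqP|i]; last exact: ltW.
by rewrite gt_eqF//; apply: prodr_gt0 => i _; rewrite subr_gt0.
Qed.

(** * Explicit eigenfunctions and moments of an arbitrary one *)

Section mode_moments.
Context {R : realType} {n : nat} (a b : 'rV[R]_n.+1).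
Hypothesis ab : forall i, a ord0 i < b ord0 i.
Local Notation Rn := 'rV[R]_n.+1.
Local Notation leb := (lebesgue_rV n.+1).
Local Notation Omega := (box a b).
Local Notation mode := (mode a b).
Local Notation freq := (freq a b).
Implicit Types (u v phi psi : Rn -> R) (g h : 'I_n.+1 -> Rn -> R) (x : Rn).
Implicit Types (j : 'I_n.+1 -> nat) (lam : R).

Let mOmega : measurable Omega. Proof. exact: measurable_box. Qed.

Let Omega_fin : (leb Omega < +oo)%E. Proof. exact: (@box_finite_measure R n.+1). Qed.

Lemma integrable_mul_smooth u phi : square_integrable leb Omega u -> smooth phi ->
  leb.-integrable Omega (EFin \o (fun x => u x * phi x)).
Proof.
move=> su Sphi; have [M phiM] := continuous_bounded_box a b (smooth_continuous Sphi).
apply: (@integrable_sqM _ _ _ leb Omega mOmega Omega_fin u phi M su) => //.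
exact: measurable_smooth.
Qed.

Lemma dot_integral_smooth g phi : (forall i, square_integrable leb Omega (g i)) ->
  smooth phi -> dot_integral Omega g (fun i => partial i phi) =
  \sum_i \int[leb]_(x in Omega) (g i x * partial i phi x).
Proof.
move=> sg Sphi; apply: Rintegral_fsum => // i.
exact/integrable_mul_smooth/smooth_partial.
Qed.

(* Testing the eigenvalue equation against a product of cosine powers, and
   moving both derivatives onto it, gives a recursion between the moments. *)
Lemma eigen_moment lam u g j : H1 Omega u g ->
  (forall phi h, H1 Omega phi h ->
     dot_integral Omega g h = lam * \int[leb]_(x in Omega) (u x * phi x)) ->
  (\sum_i freq i ^+ 2 * (j i)%:R ^+ 2 - lam) * \int[leb]_(x in Omega) (u x * mode j x) =
  \sum_i freq i ^+ 2 * (j i * (j i).-1)%:R *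
    \int[leb]_(x in Omega) (u x * mode (drop2 i j) x).
Proof.
move=> Hug; have [su sg _] := Hug.
move=> /(_ _ _ (H1_smooth ab (smooth_mode a b j))).
rewrite dot_integral_smooth//; last exact: smooth_mode.
rewrite mulrBl => <-; rewrite mulr_suml -sumrB; apply: eq_bigr => i _.
have [C HC] := partial_mode_bound ab i j.
have := H1_by_parts Hug (smooth_partial i (smooth_mode a b j)) HC.
move/(congr1 -%R); rewrite opprK => <-.
have int k : leb.-integrable Omega (EFin \o (fun x => u x * mode k x)).
  by apply: integrable_mul_smooth => //; exact: smooth_mode.
rewrite partial2_mode.
rewrite (_ : \int[leb]_(x in Omega) (u x * (freq i ^+ 2 * _)) = \int[leb]_(x in Omega)
  (freq i ^+ 2 * (j i * (j i).-1)%:R * (u x * mode (drop2 i j) x) -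
   freq i ^+ 2 * (j i)%:R ^+ 2 * (u x * mode j x))); last first.
  by apply: eq_Rintegral => x _; ring.
rewrite RintegralB//; last 2 first.
- exact: (integrable_fZ mOmega).
- exact: (integrable_fZ mOmega).
by rewrite !RintegralZl//; ring.
Qed.

Lemma neumann_eigenfunction_cst : neumann_eigenfunction Omega 0 (cst 1).
Proof.
split.
  move=> O0; apply: (box_not_negligible ab); apply: negligibleS O0.
  by move=> x Ox /= /(_ Ox)/eqP; rewrite oner_eq0.
exists (fun i => partial i (cst 1)).
  by apply: H1_smooth => //; exact: smooth_cst.
move=> phi h _; rewrite mul0r /dot_integral.
rewrite (@eq_Rintegral _ _ _ _ _ (cst 0)) => [|x _]; last first.
  by rewrite big1// => i _; rewrite partial_indep// mul0r.
by rewrite Rintegral_cst// mul0r.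
Qed.

Definition unit_index (i : 'I_n.+1) : 'I_n.+1 -> nat := fun l => (l == i).

Lemma mode_unit i x : mode (unit_index i) x = cos (freq i * x ord0 i + phase a b i).
Proof.
rewrite (modeD1 a b i) /unit_index eqxx /cosp expr1 /mode' big1 ?mulr1// => l li.
by rewrite (negbTE li) /cosp expr0.
Qed.

Lemma neumann_eigenfunction_mode i :
  neumann_eigenfunction Omega (freq i ^+ 2) (mode (unit_index i)).
Proof.
have Sm := smooth_mode a b (unit_index i).
split.
  (* On the half of the box where [x_i] is below its midpoint the angle is less than pi / 2, so the
     cosine is positive on a set of positive measure. *)
  pose d : Rn := \row_l (if l == i then (a ord0 i + b ord0 i) / 2 else b ord0 l).
  have ad l : a ord0 l < d ord0 l.
    by rewrite mxE; case: eqP => [->|_] //; have := ab i; lra.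
  move=> O0; apply: (box_not_negligible ad); apply: negligibleS O0 => x adx /=.
  have Ox : Omega x.
    move=> l; have := adx l; rewrite mxE; case: eqP => [->|//].
    by have := ab i; move=> ? /andP[-> ?]; lra.
  move=> /(_ Ox); rewrite mode_unit => /eqP; rewrite gt_eqF//.
  have := adx i; rewrite mxE eqxx => /andP[ax xd].
  have f0 := freq_gt0 ab i.
  have E1 : freq i * x ord0 i + phase a b i = freq i * (x ord0 i - a ord0 i).
    by rewrite /phase; ring.
  rewrite E1; apply: cos_gt0_pihalf; apply/andP; split.
    by rewrite (@lt_trans _ _ 0)// ?oppr_lt0 ?divr_gt0 ?pi_gt0// mulr_gt0// subr_gt0.
  have piE : freq i * (b ord0 i - a ord0 i) = pi by exact: freqE.
  by rewrite -piE -mulrA ltr_pM2l//; lra.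
exists (fun l => partial l (mode (unit_index i))); first exact: H1_smooth.
move=> phi h Hphi; have [sphi sh _] := Hphi.
rewrite /dot_integral.
rewrite (_ : \int[leb]_(x in Omega) _ = \sum_l
    \int[leb]_(x in Omega) (h l x * partial l (mode (unit_index i)) x)); last first.
  rewrite -dot_integral_smooth//.
  by apply: eq_Rintegral => x _; apply: eq_bigr => l _; rewrite mulrC.
rewrite (bigD1 i)//= big1 ?addr0 => [|l li]; last first.
  under eq_Rintegral => x _.
    rewrite partial_mode /unit_index (negbTE li) /dcosp !mul0r oppr0 !mul0r mulr0.
    over.
  by rewrite Rintegral_cst// mul0r.
(* Here the test function [phi] is the H^1 function of [H1_by_parts], so both derivatives end up on
   the cosine. *)
have [C HC] := partial_mode_bound ab i (unit_index i).
have := H1_by_parts Hphi (smooth_partial i Sm) HC.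
move/(congr1 -%R); rewrite opprK => <-.
rewrite (_ : \int[leb]_(x in Omega) (phi x * _) = \int[leb]_(x in Omega)
    (- freq i ^+ 2 * (mode (unit_index i) x * phi x))); last first.
  apply: eq_Rintegral => x _.
  by rewrite partial2_mode /unit_index eqxx/= mul0r sub0r expr1n mul1r; ring.
rewrite RintegralZl ?mulNr ?opprK//.
have := integrable_mul_smooth sphi Sm.
by rewrite (_ : (fun x => phi x * _) = fun x => mode (unit_index i) x * phi x)//;
  apply/funext => x; rewrite mulrC.
Qed.

(** The constant [c] is the mean of [e]. The moments of [e - c] satisfy the recursion of
    [eigen_moment], because the constant 1 is itself an eigenfunction, of eigenvalue 0, and
    [lam * c = 0]. If some [j i] is positive, the left coefficient [S - lam] is positive since
    [S >= freq i ^+ 2]; induction on the total degree concludes. *)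
Lemma moments_vanish lam e : (forall i, lam < freq i ^+ 2) ->
  neumann_eigenfunction Omega lam e ->
  exists c : R, forall j, \int[leb]_(x in Omega) ((e x - c) * mode j x) = 0.
Proof.
move=> lamf [_ [g Hg eig]]; have [se sg _] := Hg.
pose V := \int[leb]_(x in Omega) (1 : R).
have V0 : V != 0.
  rewrite /V Rintegral_cst// mul1r.
  have -> : fine (leb Omega) = volume a b by [].
  rewrite /volume lebesgue_rV_box => [|i]; last exact: ltW.
  by rewrite gt_eqF//; apply: prodr_gt0 => i _; rewrite subr_gt0.
pose I j := \int[leb]_(x in Omega) (e x * mode j x).
pose J j := \int[leb]_(x in Omega) (1 * mode j x).
pose c := I (fun=> 0%N) / V.
have mode0 x : mode (fun=> 0%N) x = 1.
  by rewrite /mode big1// => i _; rewrite /cosp expr0.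
have s1 : square_integrable leb Omega (cst 1).
  by apply: square_integrable_continuous; exact: cst_continuous.
have intI j : leb.-integrable Omega (EFin \o (fun x => e x * mode j x)).
  by apply: integrable_mul_smooth => //; exact: smooth_mode.
have intJ j : leb.-integrable Omega (EFin \o (fun x => 1 * mode j x)).
  by apply: (integrable_mul_smooth s1); exact: smooth_mode.
have KE j : \int[leb]_(x in Omega) ((e x - c) * mode j x) = I j - c * J j.
  rewrite /I /J -(RintegralZl _ mOmega (intJ j)) -RintegralB//.
    by apply: eq_Rintegral => x _; ring.
  exact: (integrable_fZ mOmega).
have recI j := eigen_moment j Hg eig.
have [_ [g1 Hg1 eig1]] := neumann_eigenfunction_cst.
have recJ j := eigen_moment j Hg1 eig1.
(* At the zero index the right side of the recursion vanishes: either [lam] or the mean of [e] is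
   0. *)
have lamc : lam * c = 0.
  have := recI (fun=> 0%N); rewrite !big1 => [|i _|i _]; last 2 first.
  - by rewrite mul0n mulr0 mul0r.
  - by rewrite expr0n/= mulr0.
  rewrite sub0r mulNr => /eqP; rewrite oppr_eq0 => /eqP.
  by rewrite /c mulrA -/(I (fun=> 0%N)) => ->; rewrite mul0r.
exists c => j; rewrite KE.
have [N] := ubnP (\sum_i j i)%N; elim: N j => // N IH j jN.
have [j0|/existsNP[i /eqP ji]] := pselect (forall i, j i = 0%N).
  have -> : j = fun=> 0%N by apply/funext.
  have -> : J (fun=> 0%N) = V by apply: eq_Rintegral => x _; rewrite mode0 mulr1.
  by rewrite /c divfK// subrr.
pose S := \sum_i freq i ^+ 2 * (j i)%:R ^+ 2.
have Slam : lam < S.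
  apply: (lt_le_trans (lamf i)); rewrite /S (bigD1 i)//=.
  rewrite -[leLHS]addr0 lerD//; last by apply: sumr_ge0 => l _; rewrite mulr_ge0// sqr_ge0.
  rewrite ler_peMr ?sqr_ge0// expr_ge1// ler1n lt0n//.
have : (S - lam) * (I j - c * J j) = 0.
  have -> : (S - lam) * (I j - c * J j) =
      (S - lam) * I j - c * ((S - 0) * J j) + (lam * c) * J j by ring.
  rewrite lamc mul0r addr0 recI recJ mulr_sumr -sumrB big1// => l _.
  have -> : \int[leb]_(x in Omega) (e x * mode (drop2 l j) x) = I (drop2 l j) by [].
  have -> : \int[leb]_(x in Omega) (cst 1 x * mode (drop2 l j) x) = J (drop2 l j) by [].
  transitivity (freq l ^+ 2 * (j l * (j l).-1)%:R *
    (I (drop2 l j) - c * J (drop2 l j))); first by ring.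
  case jl : (j l) => [|m]; first by rewrite mul0n mulr0 mul0r.
  rewrite IH ?mulr0//.
  rewrite ltnS in jN; apply: leq_trans jN.
  rewrite (bigD1 l)//= [ltnRHS](bigD1 l)//= /drop2 eqxx jl/=.
  rewrite (eq_bigr j) => [|k kl]; last by rewrite (negbTE kl).
  by rewrite ltn_add2r; case: m {jl} => // m; rewrite ltnS (leq_trans (leq_pred _)).
by move/eqP; rewrite mulf_eq0 subr_eq0 gt_eqF//= => /eqP.
Qed.

End mode_moments.

(** * Polynomials converging to an indicator function *)

Section threshold_polynomials.
Context {R : realType}.
Implicit Types (r x y : R) (k N : nat).

(* On [0, 1] these polynomials converge boundedly, everywhere (r = 1/2 included),
   to the indicator of r < 1/2. *)
Definition thr k : {poly R} := (1 - 'X^(k.*2)) ^+ (k * 4 ^ k).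

Lemma horner_thr k r : (thr k).[r] = (1 - r ^+ k.*2) ^+ (k * 4 ^ k).
Proof. by rewrite /thr horner_exp hornerD hornerN hornerXn hornerC. Qed.

Lemma bernoulli_ge N x : 0 <= x <= 1 -> 1 - N%:R * x <= (1 - x) ^+ N.
Proof.
move=> /andP[x0 x1]; elim: N => [|N IH]; first by rewrite mul0r subr0 expr0.
have y0 : 0 <= 1 - x by rewrite subr_ge0.
rewrite exprS; apply: le_trans (ler_wpM2l y0 IH).
have N0 : 0 <= N%:R * x by rewrite mulr_ge0.
by rewrite -natr1; nra.
Qed.

(** Bernoulli's inequality gives [1 + N x <= (1 + x)^N], and
    [(1 - x)^N (1 + x)^N = (1 - x^2)^N <= 1]. *)
Lemma bernoulli_le N x : 0 <= x <= 1 -> (1 - x) ^+ N <= (1 + N%:R * x)^-1.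
Proof.
move=> /andP[x0 x1].
have N0 : 0 < 1 + N%:R * x by rewrite ltr_pwDl// mulr_ge0.
rewrite -[leRHS]mul1r ler_pdivlMr//.
have y0 : 0 <= 1 - x by rewrite subr_ge0.
have : 1 + N%:R * x <= (1 + x) ^+ N.
  elim: N {N0} => [|N IH]; first by rewrite mul0r addr0 expr0.
  have z0 : 0 <= 1 + x by rewrite addr_ge0.
  rewrite exprS; apply: le_trans (ler_wpM2l z0 IH).
  have N0 : 0 <= N%:R * x by rewrite mulr_ge0.
  by rewrite -natr1; nra.
move/(ler_wpM2l (exprn_ge0 N y0))/le_trans; apply.
rewrite -exprMn -subr_sqr expr1n exprn_ile1 ?subr_ge0 ?gerBl ?sqr_ge0//.
exact: exprn_ile1.
Qed.

(** Each of the [k] terms of the geometric sum (1 - y^k) / (1 - y) is at least y^k when y < 1. *)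
Lemma natr_exprn_le k y : 0 <= y <= 1 -> k%:R * y ^+ k * (1 - y) <= 1 - y ^+ k.
Proof.
move=> /andP[y0 y1]; elim: k => [|k IH]; first by rewrite !mul0r expr0 subrr.
have yk0 : 0 <= y ^+ k.+1 by rewrite exprn_ge0.
have yk1 : y ^+ k.+1 <= 1 by exact: exprn_ile1.
have := ler_wpM2l y0 IH; rewrite exprS -natr1 in yk0 yk1 *.
move: (k%:R) (y ^+ k) yk0 yk1 => K Y yk0 yk1 h.
have : 0 <= (1 - y) * (1 - y * Y) by rewrite mulr_ge0// subr_ge0.
nra.
Qed.

Lemma thr01 k r : 0 <= r <= 1 -> 0 <= (thr k).[r] <= 1.
Proof.
move=> /andP[r0 r1]; rewrite horner_thr.
have h0 : 0 <= r ^+ k.*2 by exact: exprn_ge0.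
have h1 : r ^+ k.*2 <= 1 by exact: exprn_ile1.
by rewrite exprn_ge0 ?subr_ge0//= exprn_ile1 ?subr_ge0// gerBl.
Qed.

(** The exponent is tuned so that exponent times [r ^+ k.*2] equals [k * (2 r)^(2 k)]. For [r < 1/2]
    this tends to 0, and the lower Bernoulli bound gives 1; for [r >= 1/2] it is at least [k], and
    the upper bound gives at most [1 / (k + 1)]. *)
Lemma cvg_thr r : 0 <= r <= 1 -> (thr k).[r] @[k --> \oo] --> ((r < 2^-1)%R%:R : R).
Proof.
move=> r01; have /andP[r0 r1] := r01.
have rk k : 0 <= r ^+ k.*2 <= 1 by rewrite exprn_ge0//= exprn_ile1.
have NE k : (k * 4 ^ k)%:R * r ^+ k.*2 = k%:R * ((2 * r) ^+ k) ^+ 2.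
  rewrite natrM natrX -mulrA; congr (_ * _).
  rewrite -[(_ ^+ k) ^+ 2]exprM -mul2n mulnC exprMn; congr (_ * _).
  by rewrite mulnC exprM expr2 -natrM.
case: ltP => [r2|r2] /=.
- have y0 : 0 <= 2 * r by rewrite mulr_ge0.
  have y1 : 2 * r < 1 by rewrite -ltr_pdivlMl// mulr1.
  have gc : ((1 - 2 * r)^-1 * (2 * r) ^+ k) @[k --> \oo] --> (0 : R).
    apply: cvg_geometric; by rewrite ger0_norm.
  have lc : (1 - (1 - 2 * r)^-1 * (2 * r) ^+ k) @[k --> \oo] --> (1 : R).
    by have := cvgB (cvg_cst (1 : R)) gc; rewrite subr0; exact.
  suff sq : \forall k \near \oo,
      1 - (1 - 2 * r)^-1 * (2 * r) ^+ k <= (thr k).[r] <= 1.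
    exact: (squeeze_cvgr sq lc (cvg_cst _)).
  near=> k.
  have /andP[_ ->] := thr01 k r01; rewrite andbT horner_thr.
  apply: le_trans (bernoulli_ge _ (rk k)); rewrite lerD2l lerN2 NE expr2 mulrA.
  have yk0 : 0 <= (2 * r) ^+ k by exact: exprn_ge0.
  apply: ler_wpM2r => //.
  have := @natr_exprn_le k (2 * r); rewrite y0 ltW// => /(_ isT) h.
  rewrite -[leRHS]mul1r ler_pdivlMr ?subr_gt0//; apply: (le_trans h).
  by rewrite gerBl.
- suff sq : \forall k \near \oo, 0 <= (thr k).[r] <= harmonic k.
    exact: (squeeze_cvgr sq (cvg_cst _) (@cvg_harmonic R)).
  near=> k.
  have /andP[-> _] := thr01 k r01; rewrite /= horner_thr.
  apply: (le_trans (bernoulli_le _ (rk k))).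
  have y1 : 1 <= 2 * r by rewrite -ler_pdivrMl// mulr1.
  rewrite /harmonic NE lef_pV2 ?posrE ?ltr0n//; last first.
    by rewrite ltr_pwDl// mulr_ge0// sqr_ge0.
  rewrite -natr1 addrC lerD2l -[leLHS]mulr1 ler_wpM2l//.
  by rewrite -exprM exprn_ege1.
Unshelve. all: by end_near. Qed.

End threshold_polynomials.

(** * Completeness of the cosine products *)

Section completeness.
Context {R : realType} {n : nat} (a b : 'rV[R]_n.+1).
Hypothesis ab : forall i, a ord0 i < b ord0 i.
Local Notation Rn := 'rV[R]_n.+1.
Local Notation leb := (lebesgue_rV n.+1).
Local Notation Omega := (box a b).
Local Notation mode := (mode a b).
Local Notation freq := (freq a b).
Local Notation phase := (phase a b).
Variable f : Rn -> R.
Hypothesis sf : square_integrable leb Omega f.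
Hypothesis f_mode : forall j, \int[leb]_(x in Omega) (f x * mode j x) = 0.

Let mOmega : measurable Omega. Proof. exact: measurable_box. Qed.

Let Omega_fin : (leb Omega < +oo)%E. Proof. exact: (@box_finite_measure R n.+1). Qed.

Let cosi i (x : Rn) : R := cos (freq i * x ord0 i + phase i).

Lemma smooth_poly_cos (q : {poly R}) i : smooth (fun x => q.[cosi i x]).
Proof.
under eq_fun do rewrite horner_coef.
apply: smooth_sum => m; apply: (smoothM (smooth_cst _)).
elim: (nat_of_ord m) => [|l IH].
  by rewrite (_ : (fun x : Rn => _) = cst 1)//; exact: smooth_cst.
rewrite (_ : (fun x : Rn => _) = cosi i \* (fun x => cosi i x ^+ l)).
  exact: smoothM (smooth_cos _ _ _) IH.
by apply/funext => x; rewrite exprS.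
Qed.

Lemma poly_moment (q : 'I_n.+1 -> {poly R}) :
  \int[leb]_(x in Omega) (f x * \prod_i (q i).[cosi i x]) = 0.
Proof.
(* A common number of coefficients for all the [q i]: the product of sums then expands over finite
   functions, each term being a multiple of a mode. *)
pose N := (\max_i size (q i))%N.
have qE x : \prod_i (q i).[cosi i x] =
    \sum_(h : {ffun 'I_n.+1 -> 'I_N}) (\prod_i (q i)`_(h i)) * mode (fun i => h i) x.
  have hw i : (q i).[cosi i x] = \sum_(k < N) (q i)`_k * cosi i x ^+ k.
    apply: horner_coef_wide; exact: (leq_bigmax (F := fun i => size (q i))).
  under eq_bigr => i _ do rewrite hw.
  rewrite bigA_distr_bigA; apply: eq_bigr => h _.
  by rewrite -big_split.
under eq_Rintegral => x _ do rewrite qE mulr_sumr.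
have intm h : leb.-integrable Omega (EFin \o (fun x => f x * mode h x)).
  by apply: integrable_mul_smooth => //; exact: smooth_mode.
under eq_Rintegral => x _ do under eq_bigr => h _ do rewrite mulrCA.
rewrite Rintegral_fsum // => [|h]; last exact: (integrable_fZ mOmega).
by rewrite big1// => h _; rewrite RintegralZl// f_mode mulr0.
Qed.

(** The cosine is strictly decreasing on the range of the angle, so the conditions defining a
    sub-box become comparisons of cosines. *)
Lemma cos_lt i (s t : R) : a ord0 i <= s <= b ord0 i -> a ord0 i <= t <= b ord0 i ->
  (cos (freq i * s + phase i) < cos (freq i * t + phase i)) = (t < s).
Proof.
have f0 := freq_gt0 ab i.
have in0pi r : a ord0 i <= r <= b ord0 i -> freq i * r + phase i \in `[0, pi].
  move=> /andP[ar rb]; rewrite in_itv/= -(freqE ab i).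
  have -> : freq i * r + phase i = freq i * (r - a ord0 i) by rewrite /phase; ring.
  by rewrite mulr_ge0 ?subr_ge0 ?(ltW f0)//= ler_pM2l// lerD2r.
by move=> /in0pi hs /in0pi ht; rewrite ltr_cos// ltrD2r ltr_pM2l.
Qed.

Lemma integral_subbox (s t : Rn) : (forall i, a ord0 i <= s ord0 i) ->
  (forall i, s ord0 i < t ord0 i) -> (forall i, t ord0 i <= b ord0 i) ->
  \int[leb]_(x in box s t) f x = 0.
Proof.
move=> as_ st tb.
(* The arguments are 1/2 plus a quarter of a difference of two cosines, which stays in [0, 1]. They
   are below 1/2 exactly when [x_i < t_i] and when [s_i < x_i], so the product converges to the
   indicator of the sub-box. *)
pose q k i : {poly R} :=
  (thr k \Po ((2^-1 + cos (freq i * t ord0 i + phase i) / 4)%:P - 4^-1 *: 'X)) *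
  (thr k \Po ((2^-1 - cos (freq i * s ord0 i + phase i) / 4)%:P + 4^-1 *: 'X)).
have arg01 (c d : R) : -1 <= c <= 1 -> -1 <= d <= 1 -> 0 <= 2^-1 + (c - d) / 4 <= 1.
  by move=> /andP[? ?] /andP[? ?]; apply/andP; split; lra.
have cos1 (r : R) : -1 <= cos r <= 1 by rewrite cos_geN1 cos_le1.
have arg01_t i (x : Rn) := arg01 _ _ (cos1 (freq i * t ord0 i + phase i))
  (cos1 (freq i * x ord0 i + phase i)).
have arg01_s i (x : Rn) := arg01 _ _ (cos1 (freq i * x ord0 i + phase i))
  (cos1 (freq i * s ord0 i + phase i)).
have qE k i (x : Rn) : (q k i).[cosi i x] =
    (thr k).[2^-1 + (cos (freq i * t ord0 i + phase i) - cosi i x) / 4] *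
    (thr k).[2^-1 + (cosi i x - cos (freq i * s ord0 i + phase i)) / 4].
  rewrite /q hornerM !horner_comp !hornerD !hornerN !hornerZ !hornerC !hornerX.
  by congr ((thr k).[_] * (thr k).[_]); ring.
have q01 k i (x : Rn) : 0 <= (q k i).[cosi i x] <= 1.
  rewrite qE.
  have /andP[u0 u1] := thr01 k (arg01_t i x).
  have /andP[v0 v1] := thr01 k (arg01_s i x).
  by rewrite mulr_ge0//= mulr_ile1.
have qcvg i (x : Rn) : Omega x ->
    (q k i).[cosi i x] @[k --> \oo] --> ((s ord0 i < x ord0 i < t ord0 i)%R%:R : R).
  move=> Ox.
  have xi : a ord0 i <= x ord0 i <= b ord0 i by exact: box_closed Ox i.
  have ti : a ord0 i <= t ord0 i <= b ord0 i.
    by rewrite tb andbT (le_trans (as_ i))// ltW.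
  have si : a ord0 i <= s ord0 i <= b ord0 i.
    by rewrite as_/= (le_trans _ (tb i))// ltW.
  under eq_fun do rewrite qE.
  have := cvgM (cvg_thr (arg01_t i x)) (cvg_thr (arg01_s i x)).
  have half (c d : R) : (2^-1 + (c - d) / 4 < 2^-1) = (c < d).
    by apply/idP/idP => ?; lra.
  by rewrite !half !cos_lt// -natrM mulnb andbC; exact.
have wcvg (x : Rn) : Omega x -> (\prod_i (q k i).[cosi i x]) @[k --> \oo] -->
    \prod_i ((s ord0 i < x ord0 i < t ord0 i)%R%:R : R).
  move=> Ox; elim: (index_enum _) => [|i r IH].
    by under eq_fun do rewrite big_nil; rewrite big_nil; exact: cvg_cst.
  under eq_fun do rewrite big_cons; rewrite big_cons.
  exact: cvgM (qcvg i x Ox) IH.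
have wE (x : Rn) : \prod_i ((s ord0 i < x ord0 i < t ord0 i)%R%:R : R) = \1_(box s t) x.
  rewrite indicE; case: (pselect (box s t x)) => [stx|nstx].
    by rewrite mem_set//= big1// => i _; rewrite stx.
  rewrite memNset//=; have /existsNP[i /negP ni] := nstx.
  by rewrite (bigD1 i)//= (negbTE ni) mul0r.
have L := @cvg_Rintegral_dominated _ _ _ leb Omega mOmega Omega_fin f
  (fun k x => \prod_i (q k i).[cosi i x]) (\1_(box s t)) 1 sf.
have sub : box s t `<=` Omega.
  by move=> x stx i; have /andP[sx xt] := stx i;
    rewrite (le_lt_trans (as_ i) sx) (lt_le_trans xt (tb i)).
have : \int[leb]_(x in Omega) (f x * \1_(box s t) x) = 0.
  apply: (cvg_unique _ (L _ _ _ _)) => //.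
  - by move=> k; apply: measurable_smooth; apply: smooth_prod => i; exact: smooth_poly_cos.
  - by apply: measurable_funTS; apply: measurable_indic; exact: measurable_box.
  - move=> k x Ox; rewrite ger0_norm; last first.
      by apply: prodr_ge0 => i _; have /andP[] := q01 k i x.
    by apply: prodr_ile1 => i _; exact: q01.
  - by move=> x Ox; rewrite -wE; exact: wcvg.
  - suff -> : (fun k => \int[leb]_(x in Omega) (f x * \prod_i (q k i).[cosi i x])) = cst 0.
      exact: cvg_cst.
    by apply/funext => k; exact: poly_moment.
move=> <-; rewrite -[in LHS](setIidr sub) Rintegral_mkcondr.
apply: eq_Rintegral => x _; rewrite patchE indicE.
by case: ifP => _; rewrite ?mulr1 ?mulr0.
Qed.

(** Vanishing on sub-boxes extends by Dynkin induction to all measurable subsets of the box, and an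
    integrable function whose integrals all vanish is zero almost everywhere. *)
Lemma ae_zero_of_moments : ae_eq_in Omega f (cst 0).
Proof.
have intf : leb.-integrable Omega (EFin \o f) by exact: integrable_sq.
have boxP A : boxes A -> (\int[leb]_(x in Omega `&` A) (f x)%:E)%E = 0%E.
  move=> [c [d ->]]; rewrite boxI; set s := \row_i _; set t := \row_i _.
  have [[i ts]|st] := pselect (exists i, t ord0 i <= s ord0 i).
    by rewrite (box_empty ts) integral_set0.
  have sub : box s t `<=` Omega by rewrite /s /t -boxI; exact: subIsetl.
  have := @integral_subbox s t; rewrite /Rintegral => H.
  have fin : (\int[leb]_(x in box s t) (f x)%:E)%E \is a fin_num.
    have ib : leb.-integrable (box s t) (EFin \o f).
      exact: (integrableS mOmega (measurable_box s t) sub).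
    exact: (integrable_fin_num (measurable_box s t) ib).
  have lt_st i : s ord0 i < t ord0 i.
    by rewrite ltNge; apply/negP => ?; apply: st; exists i.
  by rewrite -(fineK fin) (H _ lt_st)// => i; rewrite mxE ?le_max ?ge_min lexx.
have P A : measurable A -> (\int[leb]_(x in Omega `&` A) (f x)%:E)%E = 0%E.
  rewrite rV_measurableE.
  apply: (@dynkin_induction _ Rn boxes
    (fun A => (\int[leb]_(x in Omega `&` A) (f x)%:E)%E = 0%E)).
  - exact: rV_measurableE.
  - exact: setI_closed_boxes.
  - rewrite setIT; have := boxP Omega; rewrite setIid; apply.
    by exists a, b.
  - exact: boxP.
  - move=> S mS PS.
    have OT : (\int[leb]_(x in Omega) (f x)%:E)%E = 0%E.
      by have := boxP Omega; rewrite setIid; apply; exists a, b.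
    move: OT; rewrite -{1}(setUIDK Omega S) integral_setU//=; last 4 first.
    + exact: measurableI.
    + exact: measurableD.
    + by rewrite setUIDK; exact: measurable_int intf.
    + by apply/disj_set2P; rewrite setDE setIACA setICr setI0.
    by rewrite PS add0e setDE.
  - move=> F mF tF PF; rewrite setI_bigcupr integral_bigcup//.
    + by apply: eseries0 => k _ _; exact: PF.
    + by apply: trivIset_setIl.
    + by move=> k; exact: measurableI.
    + rewrite -setI_bigcupr; apply: (integrableS mOmega) => //.
      by apply: measurableI => //; exact: bigcupT_measurable.
have : ae_eq leb Omega (EFin \o f) (cst 0%E).
  apply: integral_ae_eq => //.
  move=> E EO mE; rewrite integral_cst// mul0e -(setIidr EO).
  exact: P.
apply: filterS => x /= fx Ox; have := fx Ox.
by move=> [].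
Qed.

End completeness.

(** * The cotangent inequality *)

Section cotangent.
Context {R : realType}.

Lemma MVT_derive (f df : R -> R) (a b : R) : a < b ->
  (forall x : R, is_derive x 1 f (df x)) ->
  exists2 c, a < c < b & f b - f a = df c * (b - a).
Proof.
move=> ab fdf; have [] := @MVT R f df a b ab.

- apply: derivable_within_continuous => x _; exact: (@ex_derive _ _ _ _ _ _ _ (fdf x)).
- by move=> c; rewrite in_itv/= => ? ?; exists c.
Qed.

(* The function k below vanishes at 0 and pi/2, and k' = x m(x) where m vanishes
   at 0 and m' changes sign at most once, from + to -. *)
Lemma cot_ge (th : R) : 0 < th <= pi / 2 ->
  1 - 4 * th ^+ 2 / pi ^+ 2 <= th * cos th / sin th.
Proof.
move=> /andP[th0 thpi].
have pi0 : 0 < pi :> R by exact: pi_gt0.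
have sinth : 0 < sin th.
  by apply: sin_gt0_pi; rewrite th0/= (le_lt_trans thpi)// ltr_pdivrMr// ltr_pMr// ltr1n.
rewrite ler_pdivlMr//.
have -> : 4 * th ^+ 2 / pi ^+ 2 = (4 / pi ^+ 2) * th ^+ 2 by ring.
have : 4 / pi ^+ 2 * (pi / 2) ^+ 2 = 1 :> R.
  by move: pi pi0 => p p0; field; exact: lt0r_neq0.
have : 0 < 4 / pi ^+ 2 :> R by rewrite divr_gt0// exprn_gt0.
move: (4 / pi ^+ 2) => q q0 qpi.
pose m x : R := q * x * cos x - (1 - 2 * q) * sin x.
pose m' x : R := (3 * q - 1) * cos x - q * x * sin x.
pose k x : R := sin x * (q * x ^+ 2 - 1) + x * cos x.
have dm (x : R) : is_derive x 1 m (m' x).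
  by apply: is_derive_eq; rewrite /GRing.scale/= /m'; ring.
have dk (x : R) : is_derive x 1 k (x * m x).
  by apply: is_derive_eq; rewrite /GRing.scale/= /m; ring.
suff : 0 <= k th by rewrite /k; lra.
(* If [k th < 0], mean values of [k] on both sides of [th] give [m x1 < 0 < m x2]; mean values of
   [m] on [0, x1] and [x1, x2] then give [y1 < y2] with [m' y1 < 0 < m' y2], the wrong order of
   signs. *)
rewrite leNgt; apply/negP => kth.
have k0 : k 0 = 0 by rewrite /k sin0 !mul0r add0r.
have m0 : m 0 = 0 by rewrite /m sin0 !mulr0 !mul0r subr0.
have kpi : k (pi / 2) = 0 by rewrite /k sin_pihalf cos_pihalf qpi subrr !mulr0 addr0.
have thpi' : th < pi / 2.
  by rewrite lt_neqAle thpi andbT; apply: contraTneq kth => ->; rewrite kpi ltxx.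
have [x1 /andP[x10 x1th]] := MVT_derive th0 dk.
rewrite k0 !subr0 => kE1.
have [x2 /andP[x2th x2pi]] := MVT_derive thpi' dk.
rewrite kpi sub0r => kE2.
have x20 : 0 < x2 by exact: lt_trans x2th.
have mx1 : m x1 < 0.
  by move: kth; rewrite kE1 pmulr_llt0// pmulr_rlt0.
have mx2 : 0 < m x2.
  have : 0 < - k th by rewrite oppr_gt0.
  have d0 : 0 < pi / 2 - th by rewrite subr_gt0.
  by rewrite kE2 (pmulr_lgt0 _ d0) (pmulr_rgt0 _ x20).
have [y1 /andP[y10 y1x]] := MVT_derive x10 dm.
rewrite m0 !subr0 => mE1.
have x12 : x1 < x2 by exact: lt_trans x2th.
have [y2 /andP[y2x y2x2] mE2] := MVT_derive x12 dm.
have my1 : m' y1 < 0 by move: mx1; rewrite mE1 pmulr_llt0.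
have my2 : 0 < m' y2.
  have : 0 < m x2 - m x1 by rewrite subr_gt0 (lt_trans mx1).
  by rewrite mE2 pmulr_lgt0 // subr_gt0.
have y12 : y1 < y2 by exact: lt_trans y2x.
have y20 : 0 < y2 by exact: lt_trans y12.
have y2pi : y2 < pi / 2 by exact: lt_trans x2pi.
have y1pi : y1 < pi / 2 by exact: lt_trans y2pi.
have sy1 : 0 <= sin y1 by rewrite ltW// sin_gt0_pihalf// y10.
have sy2 : 0 <= sin y2 by rewrite ltW// sin_gt0_pihalf// y20.
have cy2 : 0 <= cos y2 by rewrite cos_ge0_pihalf// !ltW// (lt_trans _ y20)// oppr_lt0 divr_gt0.
have c12 : cos y2 <= cos y1.
  have pi2 : pi / 2 < pi :> R by rewrite ltr_pdivrMr// ltr_pMr// ltr1n.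
  by rewrite ltW// ltr_cos// in_itv/= !ltW// (lt_trans _ pi2).
have s12 : sin y1 <= sin y2.
  by rewrite ltW// ltr_sin// in_itv/= !ltW// ?(lt_trans _ y10)
    ?(lt_trans _ y20)// oppr_lt0 divr_gt0.
have ys : y1 * sin y1 <= y2 * sin y2 by apply: ler_pM => //; exact: ltW.
have qs : q * (y1 * sin y1) <= q * (y2 * sin y2) by rewrite ler_wpM2l// ltW.
have qs2 : 0 <= q * (y2 * sin y2) by rewrite !mulr_ge0// ltW.
move: my1 my2; rewrite /m' -!mulrA.
(* If [3 * q - 1] is nonnegative, then [m' y2 <= m' y1], a contradiction. Otherwise both terms of
   [m' y2] are nonpositive. *)
have [q3|q3] := leP 0 (3 * q - 1).
  have := ler_wpM2l q3 c12; lra.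
have : (3 * q - 1) * cos y2 <= 0 by rewrite mulr_le0_ge0// ltW.
lra.
Qed.

End cotangent.

(** * The limit value compared with the bound *)

Section limit_value.
Context {R : realType} {n : nat}.
Variables (L : 'I_n -> R) (V Lm : R).
Hypotheses (L0 : forall i, 0 < L i) (V0 : 0 < V).
Hypotheses (LLm : forall i, L i <= Lm) (Lm_max : exists i, L i = Lm).

Let th j := pi / Lm * L j / 2.
Let P := \sum_j 2 * V / L j.
Let bound := (n%:R - 1) / n%:R * (P ^+ 2 / V).
Let limit := \sum_j (2 * V / L j * (pi / Lm * (cos (th j) / sin (th j))) +
                     \sum_(i | i != j) 4 * V / (L i * L j)).

(** With [S] the sum of the inverse sides, completing the off-diagonal terms to [S ^+ 2] gives
    [limit - bound = 4 V S^2 / n - \sum_j br j]. Here [br j <= 4 V / Lm^2] by the cotangent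
    inequality, and [S >= n / Lm]. *)
Lemma limit_value_ge : bound <= limit /\
  (limit = bound <-> forall i j, L i = L j).
Proof.
have sumC (x : R) : \sum_(j < n) x = n%:R * x.
  by rewrite sumr_const card_ord mulr_natl.
have [i0 Li0] := Lm_max.
have Lm0 : 0 < Lm by rewrite -Li0.
have n0 : 0 < n%:R :> R by rewrite ltr0n (leq_ltn_trans _ (ltn_ord i0)).
have pi0 : 0 < pi :> R by exact: pi_gt0.
pose S := \sum_j (L j)^-1.
pose br j := 4 * V / L j ^+ 2 - 2 * V / L j * (pi / Lm * (cos (th j) / sin (th j))).
have PE : P = 2 * V * S by rewrite /P /S mulr_sumr.
have lbE : limit - bound = 4 * V * (S ^+ 2 / n%:R) - \sum_j br j.
  have -> : limit = 4 * V * S ^+ 2 - \sum_j br j.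
    rewrite /limit expr2 mulr_suml mulr_sumr -sumrB; apply: eq_bigr => j _.
    rewrite /br.
    suff -> : \sum_(i | i != j) 4 * V / (L i * L j) =
        4 * V * ((L j)^-1 * S) - 4 * V / L j ^+ 2 by ring.
    rewrite /S [in RHS](bigD1 j)//= mulrDr mulrDr.
    rewrite mulr_sumr mulr_sumr addrAC (_ : _ - _ = 0).
      rewrite add0r; apply: eq_bigr => i _.
      by field; rewrite !lt0r_neq0.
    by apply/eqP; rewrite subr_eq0; apply/eqP; field; exact: lt0r_neq0.
  rewrite /bound PE; field.
  by rewrite ?lt0r_neq0.
have brle j : br j <= 4 * V / Lm ^+ 2.
  have h : 0 < th j <= pi / 2.
    have th0 : 0 < th j by rewrite /th divr_gt0// mulr_gt0// divr_gt0.
    rewrite th0/= /th.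
    by rewrite ler_pM2r ?invr_gt0// mulrAC ler_pdivrMr// ler_pM2l.
  (* Multiplication by [4 * V / L j ^+ 2] turns [4 * th^2 / pi^2] into [(L j / Lm)^2], so that the
     resulting bound does not depend on [j]. *)
  have := cot_ge h.
  have k0 : 0 < 4 * V / L j ^+ 2 by rewrite divr_gt0 ?mulr_gt0 ?exprn_gt0.
  move/(ler_wpM2l (ltW k0)).
  rewrite (_ : _ * (1 - _) = 4 * V / L j ^+ 2 - 4 * V / Lm ^+ 2); last first.
    rewrite /th; move: pi (pi0) => p p0; field; rewrite !lt0r_neq0//=; exact: L0.
  rewrite (_ : _ * (_ / _) = 2 * V / L j * (pi / Lm * (cos (th j) / sin (th j)))); last first.
    move: (cos _) (sin _)^-1 => c s.
    rewrite /th; move: pi (pi0) => p p0; field; rewrite !lt0r_neq0//=; exact: L0.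
  by rewrite /br; lra.
have sbr : \sum_j br j <= 4 * V * (n%:R / Lm ^+ 2).
  apply: le_trans (_ : \sum_(j < n) 4 * V / Lm ^+ 2 <= _).
    by apply: ler_sum => j _; exact: brle.
  by rewrite sumC le_eqVlt; apply/orP; left; apply/eqP; ring.
have LVle j : Lm^-1 <= (L j)^-1 by rewrite lef_pV2// posrE.
have Sge : n%:R / Lm <= S.
  apply: le_trans (_ : \sum_(j < n) Lm^-1 <= _).
    by rewrite sumC.
  by apply: ler_sum => j _.
have S0 : 0 < S by apply: lt_le_trans Sge; rewrite divr_gt0.
have S2 : 4 * V * (n%:R / Lm ^+ 2) <= 4 * V * (S ^+ 2 / n%:R).
  rewrite ler_pM2l ?mulr_gt0// ler_pdivlMr//.
  rewrite (_ : n%:R / Lm ^+ 2 * n%:R = (n%:R / Lm) ^+ 2); last first.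
    by field; rewrite ?lt0r_neq0.
  by rewrite lerXn2r// nnegrE ltW// divr_gt0.
split; first by rewrite -subr_ge0 lbE subr_ge0 (le_trans sbr).
split.
  (* Equality forces [S = n / Lm]; the nonnegative differences [(L j)^-1 - Lm^-1] then have sum 0
     and vanish one by one. *)
  move=> /eqP; rewrite -subr_eq0 lbE subr_eq0 => /eqP E.
  have : 4 * V * (S ^+ 2 / n%:R) <= 4 * V * (n%:R / Lm ^+ 2) by rewrite E.
  rewrite ler_pM2l ?mulr_gt0// ler_pdivrMr//.
  rewrite (_ : n%:R / Lm ^+ 2 * n%:R = (n%:R / Lm) ^+ 2); last first.
    by field; rewrite ?lt0r_neq0.
  rewrite ler_pXn2r ?nnegrE ?(ltW S0) ?(ltW (divr_gt0 n0 Lm0))// => Sle.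
  have : \sum_j ((L j)^-1 - Lm^-1) == 0.
    rewrite sumrB sumC subr_eq0 eq_le.
    by rewrite Sle.
  rewrite psumr_eq0 => [/allP H|j _]; last by rewrite subr_ge0.
  suff LE j : L j = Lm by move=> i j; rewrite !LE.
  have := H j (mem_index_enum _); rewrite /= subr_eq0 => /eqP.
  exact: invr_inj.
move=> Leq; have LE j : L j = Lm by rewrite (Leq j i0).
apply/eqP; rewrite -subr_eq0 lbE subr_eq0; apply/eqP.
have -> : S = n%:R / Lm.
  by rewrite /S; under eq_bigr do rewrite LE; rewrite sumC.
(* In a cube every [th j] equals pi / 2, where the cotangent is 0. *)
have brE j : br j = 4 * V / Lm ^+ 2.
  by rewrite /br /th LE divfK ?gt_eqF// cos_pihalf mul0r !mulr0 subr0.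
under eq_bigr do rewrite brE.
rewrite sumC.
by field; rewrite ?lt0r_neq0.
Qed.

End limit_value.

(** * The second Neumann eigenvalue of a box *)

Section second_eigenvalue.
Context {R : realType} {n : nat} (a b : 'rV[R]_n.+1).
Hypothesis ab : forall i, a ord0 i < b ord0 i.
Local Notation Rn := 'rV[R]_n.+1.
Local Notation leb := (lebesgue_rV n.+1).
Local Notation Omega := (box a b).
Local Notation freq := (freq a b).

Let mOmega : measurable Omega. Proof. exact: measurable_box. Qed.

Lemma low_eigenfunction_cst (lam : R) e : (forall i, lam < freq i ^+ 2) ->
  neumann_eigenfunction Omega lam e -> exists c, ae_eq_in Omega e (cst c).
Proof.
move=> lamf eig; have [c ec] := moments_vanish ab lamf eig.
have [_ [g [se _ _] _]] := eig; exists c.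
have sc : square_integrable leb Omega (cst c).
  by apply: square_integrable_continuous; exact: cst_continuous.
have := ae_zero_of_moments ab (square_integrableB mOmega se sc) ec.
by apply: filterS => x ex0 Ox; apply/eqP; rewrite -subr_eq0; apply/eqP; exact: ex0.
Qed.

Lemma neumann_mu2 (mu : nat -> R) (i0 : 'I_n.+1) : neumann_spectrum Omega mu ->
  (forall i, freq i0 <= freq i) -> mu 1%N = freq i0 ^+ 2.
Proof.
move=> [mu_nd [e [eig indep complete]]] i0min.
have mu_le k l : (k <= l)%N -> mu k <= mu l.
  by elim: l => [|l IH]; [rewrite leqn0 => /eqP->|rewrite leq_eqVlt => /predU1P[->//|];
    rewrite ltnS => /IH/le_trans; apply].
(* For a value outside the list all coefficients of the expansion would be 0, and so would the
   eigenfunction. *)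
have listed lam u : neumann_eigenfunction Omega lam u -> exists k, mu k = lam.
  move=> eu; have [N [r [r0 ur]]] := complete _ _ eu.
  apply: contrapT => nk; case: eu => + _; apply.
  apply: filterS ur => x + Ox => /(_ Ox) ->.
  rewrite big1// => k _; rewrite r0 ?mul0r//.
  by apply/eqP => kl; apply: nk; exists k.
have f0 i : 0 < freq i by exact: freq_gt0.
apply/eqP; rewrite eq_le; apply/andP; split.
  (* The positive value [freq i0 ^+ 2] cannot sit at index 0, since the smaller value 0 is listed as
     well. Its index is at least 1, which bounds [mu 1] from above. *)
  have [k muk] := listed _ _ (neumann_eigenfunction_mode ab i0).
  have [l mul] := listed _ _ (neumann_eigenfunction_cst ab).
  case: k muk => [mu0|k <-]; last exact: mu_le.
  have := mu_le _ _ (leq0n l); rewrite mul mu0 leNgt exprn_gt0//.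
rewrite leNgt; apply/negP => mu1.
have low k : (k <= 1)%N -> forall i, mu k < freq i ^+ 2.
  move=> k1 i; apply: (le_lt_trans (mu_le _ _ k1)); apply: (lt_le_trans mu1).
  by rewrite lerXn2r// nnegrE ltW.
have [c0 e0] := low_eigenfunction_cst (low 0%N isT) (eig 0%N).
have [c1 e1] := low_eigenfunction_cst (low 1%N isT) (eig 1%N).
(* If the first two eigenfunctions were the constants [c0] and [c1], then [c1 * e 0 - c0 * e 1]
   would vanish; independence forces [c0 = 0], against [e 0] being nonzero. *)
pose r (k : 'I_2) := if k == ord0 then c1 else - c0.
have /(_ r) h := indep 2%N.
have {}h : forall k, r k = 0.
  apply: h; apply: filterS2 e0 e1 => x /= h0 h1 Ox.
  rewrite big_ord_recl big_ord1 /r/= h0// h1//; ring.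
have c00 : c0 = 0 by apply/eqP; rewrite -oppr_eq0; apply/eqP; exact: (h (lift ord0 ord0)).
have [+ _] := eig 0%N; apply.
by move: e0; rewrite c00.
Qed.

End second_eigenvalue.

Lemma cvg_fsum {R : realType} {T I : Type} (F : set_system T) {FF : Filter F}
    (r : seq I) (f : I -> T -> R) (l : I -> R) :
  (forall i, f i x @[x --> F] --> l i) ->
  \sum_(i <- r) f i x @[x --> F] --> \sum_(i <- r) l i.
Proof. by move=> fl; apply: cvg_big => //; exact: add_continuous. Qed.

(** * The explicit solution and its boundary integral *)

Section explicit_solution.
Context {R : realType} {n : nat} (a b : 'rV[R]_n.+1).
Hypothesis ab : forall i, a ord0 i < b ord0 i.
Local Notation Rn := 'rV[R]_n.+1.
Local Notation leb := (lebesgue_rV n.+1).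
Local Notation Omega := (box a b).
Implicit Types (u phi psi : Rn -> R) (x : Rn).
Variable k : R.
Hypothesis k0 : 0 < k.

Let L i : R := b ord0 i - a ord0 i.
Let th i : R := k * L i / 2.
Hypothesis sin_th : forall i, 0 < sin (th i).
(** Centring the cosine at the midpoint of the side makes its values on the two opposite faces
    equal, and likewise its outer normal derivatives. *)
Let mid i : R := - (k * ((a ord0 i + b ord0 i) / 2)).
Let A i : R := (k * sin (th i))^-1.

Let mOmega : measurable Omega. Proof. exact: measurable_box. Qed.

Let Omega_fin : (leb Omega < +oo)%E. Proof. exact: (@box_finite_measure R n.+1). Qed.

Let w i x : R := A i * cos (k * x ord0 i + mid i).

Let dw i x : R := - (A i * k * sin (k * x ord0 i + mid i)).

(* [A i] is chosen so that the outer normal derivative is -1 on every face. *)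
Definition sol x : R := \sum_i w i x.

Let smooth_w i : smooth (w i).
Proof. exact: smoothM (smooth_cst _) (smooth_cos _ _ _). Qed.

Let smooth_dw i : smooth (dw i).
Proof.
rewrite (_ : dw i = fun x => 0 * cos (k * x ord0 i + mid i) +
   - (A i * k) * sin (k * x ord0 i + mid i)); first exact: smooth_trig.
by apply/funext => x; rewrite mul0r add0r mulNr.
Qed.

Lemma smooth_sol : smooth sol.
Proof. exact: smooth_sum. Qed.

Let partial_w i : partial i (w i) = dw i.
Proof.
apply/funext => x.
have h := is_derive_cosp1 k (mid i) (x ord0 i).
have h' : is_derive (x ord0 i) 1 (fun s => A i * cos (k * s + mid i)) (dw i x).
  by apply: is_derive_eq; rewrite /GRing.scale/= /dw; ring.
by have [_] := is_derive_coord h'.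
Qed.

Let partial_dw i : partial i (dw i) = fun x => - (k ^+ 2 * w i x).
Proof.
apply/funext => x.
have h := is_derive_sinp1 k (mid i) (x ord0 i).
have h' : is_derive (x ord0 i) 1 (fun s => - (A i * k * sin (k * s + mid i)))
    (- (k ^+ 2 * w i x)).
  by apply: is_derive_eq; rewrite /GRing.scale/= /w; ring.
by have [_] := is_derive_coord h'.
Qed.

Let partial_w_neq i j : i != j -> partial i (w j) = cst 0.
Proof.
by move=> ij; apply: (@partial_coord_neq R n.+1 i j (fun s => A j * cos (k * s + mid j)));
  rewrite eq_sym.
Qed.

Lemma partial_sol i : partial i sol = dw i.
Proof.
have -> : sol = w i \+ (fun x => \sum_(j | j != i) w j x).
  by apply/funext => x; rewrite /sol (bigD1 i).
apply/funext => x; rewrite partialD//; last exact: smooth_sum.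
rewrite partial_w partial_indep ?addr0// => h y.
apply: eq_bigr => j ji; rewrite /w; congr (_ * cos (_ * _ + _)).
by rewrite !mxE (negbTE ji)/= ?andbF mulr0 add0r.
Qed.

Let dw_b i x : x ord0 i = b ord0 i -> dw i x = -1.
Proof.
move=> xb; rewrite /dw xb (_ : k * b ord0 i + mid i = th i).
  by rewrite /A; field; rewrite !lt0r_neq0.
by rewrite /mid /th /L; field.
Qed.

Let dw_a i x : x ord0 i = a ord0 i -> dw i x = 1.
Proof.
move=> xa; rewrite /dw xa (_ : k * a ord0 i + mid i = - th i).
  by rewrite sinN /A; field; rewrite !lt0r_neq0.
by rewrite /mid /th /L; field.
Qed.

Let face i phi : R :=
  \int[lebesgue_rV n]_(y in box (col' i a) (col' i b)) phi (@insert R n.+1 i (a ord0 i) y) +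
  \int[lebesgue_rV n]_(y in box (col' i a) (col' i b)) phi (@insert R n.+1 i (b ord0 i) y).

Let integral_surfaceE phi : continuous phi -> \int[surface a b]_x phi x = \sum_i face i phi.
Proof. exact: Rintegral_surface. Qed.

(** Divergence theorem for a field along the [i]-th axis whose outer normal component is [r * phi]
    on both faces. It is used with the derivative of the solution ([r = -1]) and with a centred
    coordinate ([r] half a side). *)
Let flux i (psi phi : Rn -> R) (r : R) : smooth psi -> smooth phi ->
  (forall x, x ord0 i = b ord0 i -> psi x = r) ->
  (forall x, x ord0 i = a ord0 i -> psi x = - r) ->
  \int[leb]_(x in Omega) partial i (psi \* phi) x = r * face i phi.
Proof.
move=> Spsi Sphi pb pa; rewrite (Rintegral_partial (ab i)); last exact: smoothM.
have ci s : continuous (fun y : 'rV[R]_n => phi (@insert R n.+1 i s y)).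
  move=> y; apply: continuous_comp; first exact: continuous_insert_snd.
  exact: smooth_continuous.
have ii s : (lebesgue_rV n).-integrable (box (col' i a) (col' i b))
    (EFin \o (fun y => phi (@insert R n.+1 i s y))).
  exact: integrable_box_continuous.
have mB := measurable_box (col' i a) (col' i b).
under eq_Rintegral => y _ do rewrite /= pb ?insertE//.
under [X in _ - X]eq_Rintegral => y _ do rewrite /= pa ?insertE//.
by rewrite !RintegralZl// /face; ring.
Qed.

Let green_i i phi : smooth phi ->
  \int[leb]_(x in Omega) (partial i phi x * dw i x) + face i phi =
  k ^+ 2 * \int[leb]_(x in Omega) (phi x * w i x).
Proof.
move=> Sphi; have := flux (smooth_dw i) Sphi (dw_b (i := i)) (r := -1).
rewrite opprK => /(_ (dw_a (i := i))).
have cM phi1 phi2 : smooth phi1 -> smooth phi2 ->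
    leb.-integrable Omega (EFin \o (fun x => phi1 x * phi2 x)).
  move=> S1 S2; apply: (@integrable_box_continuous _ n.+1).
  by apply: continuousM_fun; exact: smooth_continuous.
under eq_Rintegral => x _ do rewrite partialM// partial_dw.
rewrite (_ : \int[leb]_(x in Omega) _ = \int[leb]_(x in Omega)
   (partial i phi x * dw i x + - k ^+ 2 * (phi x * w i x))); last first.
  by apply: eq_Rintegral => x _; ring.
rewrite RintegralD//; last 2 first.
- by apply: cM => //; exact: smooth_partial.
- exact/(integrable_fZ mOmega)/cM.
rewrite RintegralZl//; last exact: cM.
by move=> h; lra.
Qed.

Lemma green_sol phi : smooth phi ->
  \sum_i \int[leb]_(x in Omega) (partial i phi x * partial i sol x) +
    \int[surface a b]_x phi x =
  k ^+ 2 * \int[leb]_(x in Omega) (phi x * sol x).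
Proof.
move=> Sphi; rewrite integral_surfaceE; last exact: smooth_continuous.
have cphi := square_integrable_continuous a b (smooth_continuous Sphi).
under [in RHS]eq_Rintegral => x _ do rewrite /sol mulr_sumr.
rewrite Rintegral_fsum// => [|i]; last exact: integrable_mul_smooth.
rewrite mulr_sumr -big_split; apply: eq_bigr => i _.
by rewrite -green_i//; under eq_Rintegral => x _ do rewrite partial_sol.
Qed.

(** The identity holds for the smooth functions that define the trace; each of its terms passes to
    the limit because [sol], its partial derivatives and the constant 1 are bounded multipliers. *)
Lemma green_sol_trace u g t : H1 Omega u g -> is_trace a b u g t ->
  \sum_i \int[leb]_(x in Omega) (g i x * partial i sol x) +
    \int[surface a b]_x t x =
  k ^+ 2 * \int[leb]_(x in Omega) (u x * sol x).
Proof.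
move=> [su sg _] [st [phi [Sphi phiu phig phit]]].
have bounded psi : smooth psi -> exists M, forall x, Omega x -> `|psi x| <= M.
  by move=> Spsi; exact/continuous_bounded_box/smooth_continuous.
have sint psi : smooth psi -> square_integrable leb Omega psi.
  by move=> Spsi; exact/square_integrable_continuous/smooth_continuous.
have Lu : (\int[leb]_(x in Omega) (phi m x * sol x)) @[m --> \oo] -->
    \int[leb]_(x in Omega) (u x * sol x).
  have [M HM] := bounded _ smooth_sol.
  apply: (@cvg_Rintegral_L2 _ _ _ leb _ mOmega Omega_fin phi u sol M) => //.
  - by move=> m; exact: sint.
  - by apply: measurable_smooth; exact: smooth_sol.
have Lg i : (\int[leb]_(x in Omega) (partial i (phi m) x * partial i sol x)) @[m --> \oo] -->
    \int[leb]_(x in Omega) (g i x * partial i sol x).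
  have [M HM] := bounded _ (smooth_partial i smooth_sol).
  apply: (@cvg_Rintegral_L2 _ _ _ leb _ mOmega Omega_fin
    (fun m => partial i (phi m)) (g i) (partial i sol) M) => //.
  - by move=> m; exact/sint/smooth_partial.
  - by apply: measurable_smooth; apply: smooth_partial; exact: smooth_sol.
have Lt : (\int[surface a b]_x phi m x) @[m --> \oo] --> \int[surface a b]_x t x.
  have mul1 f : \int[surface a b]_x (f x * cst 1 x) = \int[surface a b]_x f x.
    by apply: eq_Rintegral => x _; rewrite mulr1.
  have := @cvg_Rintegral_L2 _ _ _ (surface a b) _ (@measurableT _ Rn) (surface_finite a b)
    phi t (cst 1) 1.
  rewrite mul1 (funext (fun m => mul1 (phi m))); apply => //.
  - by move=> m; exact/square_integrable_surface/smooth_continuous.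
  - by move=> x _; rewrite normr1.
have L1 : (\sum_i \int[leb]_(x in Omega) (partial i (phi m) x * partial i sol x) +
    \int[surface a b]_x phi m x) @[m --> \oo] -->
    \sum_i \int[leb]_(x in Omega) (g i x * partial i sol x) + \int[surface a b]_x t x.
  by apply: cvgD => //; apply: cvg_fsum => i; exact: Lg.
have L2 : (k ^+ 2 * \int[leb]_(x in Omega) (phi m x * sol x)) @[m --> \oo] -->
    k ^+ 2 * \int[leb]_(x in Omega) (u x * sol x).
  by apply: cvgM => //; exact: cvg_cst.
apply: (cvg_unique _ L1 _) => //.
suff -> : (fun m => \sum_i \int[leb]_(x in Omega) (partial i (phi m) x * partial i sol x) +
    \int[surface a b]_x phi m x) =
   (fun m => k ^+ 2 * \int[leb]_(x in Omega) (phi m x * sol x)) by exact: L2.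
by apply/funext => m; exact: green_sol.
Qed.

Lemma boundary_integral_eq u t : weak_solution a b (k ^+ 2) u -> boundary_value a b u t ->
  \int[surface a b]_x t x = \int[surface a b]_x sol x.
Proof.
move=> [g Hg weak] [g' Hg' tr].
have := weak _ _ _ (H1_smooth ab smooth_sol) (is_trace_smooth a b smooth_sol).
rewrite -(green_sol_trace Hg' tr) dot_integral_smooth; [|by case: Hg|exact: smooth_sol].
(* The weak equation and the trace come with possibly different gradients [g] and [g']; against the
   smooth [partial i sol] they give the same integral. *)
under eq_bigr => i _ do
  rewrite (weak_gradient_unique i Hg Hg' (smooth_partial i smooth_sol)).
by move/addrI.
Qed.

Let V := volume a b.

Let L_gt0 i : 0 < L i. Proof. by rewrite subr_gt0. Qed.

(** [2 * V / L i] is the total area of the two faces orthogonal to the [i]-th axis. *)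
Let faceC i phi (r : R) :
  (forall x, x ord0 i = a ord0 i \/ x ord0 i = b ord0 i -> phi x = r) ->
  face i phi = r * (2 * V / L i).
Proof.
move=> phir.
have mB := measurable_box (col' i a) (col' i b).
have VE : V = L i * fine (lebesgue_rV n (box (col' i a) (col' i b))).
  rewrite /V /volume lebesgue_rV_box => [|j]; last exact: ltW.
  rewrite lebesgue_rV_box => [|j]; last by rewrite !mxE ltW.
  rewrite (bigD1_ord i)//=; congr (_ * _).
  by apply: eq_bigr => j _; rewrite !mxE.
have faceE s : s = a ord0 i \/ s = b ord0 i ->
    \int[lebesgue_rV n]_(y in box (col' i a) (col' i b)) phi (@insert R n.+1 i s y) =
    r * fine (lebesgue_rV n (box (col' i a) (col' i b))).
  move=> si; rewrite (@eq_Rintegral _ _ _ _ _ (cst r)) => [|y _]; last first.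
    by rewrite phir// insertE.
  by rewrite Rintegral_cst.
rewrite /face faceE ?faceE; [|by right|by left].
by rewrite VE; field; exact: lt0r_neq0.
Qed.

Lemma perimeterE : perimeter a b = \sum_i 2 * V / L i.
Proof.
have -> : perimeter a b = \int[surface a b]_x cst (1 : R) x.
  by rewrite Rintegral_cst// mul1r.
rewrite integral_surfaceE; last exact: cst_continuous.
by apply: eq_bigr => i _; rewrite (@faceC i (cst 1) 1)// mul1r.
Qed.

(** This is [green_i] with the constant test function 1, whose gradient vanishes. *)
Let int_w i : k ^+ 2 * \int[leb]_(x in Omega) w i x = 2 * V / L i.
Proof.
have := green_i i (smooth_cst 1).
rewrite (@faceC i (cst 1) 1)// mul1r.
under eq_Rintegral => x _ do rewrite partial_indep// mul0r.
rewrite Rintegral_cst// mul0r add0r => ->.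
by congr (_ * _); apply: eq_Rintegral => x _; rewrite mul1r.
Qed.

(** Since [w i] does not depend on [x_j], the field [(x_j - midpoint) * w i] has divergence [w i] in
    direction [j], which ties the face integral to the volume integral known from [int_w]. *)
Let face_w i j : i != j -> k ^+ 2 * face j (w i) = 4 * V / (L i * L j).
Proof.
move=> ij; pose psi x : R := 1 * x ord0 j + - ((a ord0 j + b ord0 j) / 2).
have Spsi : smooth psi by exact: smooth_affine.
have := @flux j psi (w i) (L j / 2) Spsi (smooth_w i).
rewrite (_ : \int[leb]_(x in Omega) _ = \int[leb]_(x in Omega) w i x); last first.
  apply: eq_Rintegral => x _; rewrite partialM// partial_w_neq 1?eq_sym// mulr0 add0r.
  have h := is_derive_affine 1 (- ((a ord0 j + b ord0 j) / 2)) (x ord0 j).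
  by have [_] := is_derive_coord h; rewrite /partial /psi => ->; rewrite mulr1.
move=> H; have {}H : \int[leb]_(x in Omega) w i x = L j / 2 * face j (w i).
  by apply: H => x xj; rewrite /psi xj /L; field.
have := int_w i; rewrite H => E.
have Lj := lt0r_neq0 (L_gt0 j); have Li := lt0r_neq0 (L_gt0 i).
have -> : k ^+ 2 * face j (w i) = (k ^+ 2 * (L j / 2 * face j (w i))) * (2 / L j).
  by field.
by rewrite E; field; rewrite Lj Li.
Qed.

Let face_ww j : k ^+ 2 * face j (w j) = 2 * V / L j * (k * (cos (th j) / sin (th j))).
Proof.
rewrite (@faceC j (w j) (A j * cos (th j))); last first.
  move=> x [] xj; rewrite /w xj; congr (_ * _).
    rewrite (_ : _ + _ = - th j) ?cosN//; by rewrite /mid /th /L; field.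
  congr cos; by rewrite /mid /th /L; field.
rewrite /A; have Lj := lt0r_neq0 (L_gt0 j); have sj := lt0r_neq0 (sin_th j).
have kn := lt0r_neq0 k0.
by move: (cos _) (sin _) sj (L j) Lj => c s sj l Lj; field; rewrite sj kn Lj.
Qed.

Lemma boundary_sol : k ^+ 2 * \int[surface a b]_x sol x =
  \sum_j (2 * V / L j * (k * (cos (th j) / sin (th j))) +
          \sum_(i | i != j) 4 * V / (L i * L j)).
Proof.
rewrite integral_surfaceE; last exact/smooth_continuous/smooth_sol.
rewrite mulr_sumr; apply: eq_bigr => j _.
have -> : face j sol = \sum_i face j (w i).
  have int s i : (lebesgue_rV n).-integrable (box (col' j a) (col' j b))
      (EFin \o (fun y => w i (@insert R n.+1 j s y))).
    apply: integrable_box_continuous => y.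
    apply: (@continuous_comp _ _ _ (@insert R n.+1 j s : 'rV[R]_n -> _) (w i)).
      exact: continuous_insert_snd.
    exact: smooth_continuous.
  rewrite /face big_split; congr (_ + _).
    by rewrite -(Rintegral_fsum (measurable_box _ _))// => i; exact: int.
  by rewrite -(Rintegral_fsum (measurable_box _ _))// => i; exact: int.
rewrite mulr_sumr (bigD1 j)//= face_ww; congr (_ + _).
by apply: eq_bigr => i ij; exact: face_w.
Qed.

End explicit_solution.

(** * The boundary integral as a function of the square root of c *)

Section limit.
Context {R : realType} {n : nat}.

(** The exact value of c times the boundary integral when [k = sqrt c] is below pi / Lmax; the limit
    sought is its value at [k = pi / Lmax]. *)
Definition boundary_limit (L : 'I_n -> R) (V k : R) : R :=
  \sum_j (2 * V / L j * (k * (cos (k * L j / 2) / sin (k * L j / 2))) +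
          \sum_(i | i != j) 4 * V / (L i * L j)).

Lemma boundary_limit_continuous (L : 'I_n -> R) (V k : R) :
  (forall i, 0 < sin (k * L i / 2)) ->
  {for k, continuous (boundary_limit L V)}.
Proof.
move=> sk; apply: cvg_fsum => j; apply: cvgD; last exact: cvg_cst.
have lin : (x * L j / 2) @[x --> k] --> k * L j / 2.
  by apply: cvgM; [apply: cvgM; [exact: cvg_id|exact: cvg_cst]|exact: cvg_cst].
apply: cvgM; first exact: cvg_cst.
apply: cvgM; first exact: cvg_id.
apply: cvgM; first exact: (continuous_cvg _ (@continuous_cos R _) lin).
apply: cvgV; first exact: lt0r_neq0.
exact: (continuous_cvg _ (@continuous_sin R _) lin).
Qed.

End limit.

Unset Implicit Arguments.

Theorem theorem1p3 (R : realType) (n : nat) (hn : (0 < n)%N)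
    (a b : 'rV[R]_n) (hab : forall i, a ord0 i < b ord0 i)
    (mu : nat -> R) (hmu : neumann_spectrum (box a b) mu)
    (u t : R -> 'rV[R]_n -> R)
    (hu : forall c : R, 0 < c < mu 1%N -> weak_solution a b c (u c))
    (ht : forall c : R, 0 < c < mu 1%N -> boundary_value a b (u c) (t c)) :
  let bound := (n%:R - 1) / n%:R * (perimeter a b ^+ 2 / volume a b) in
  exists l : R,
    [/\ (c * \int[surface a b]_x t c x) @[c --> (mu 1%N)^'-] --> l,
        bound <= l &
        l = bound <-> is_cube a b].
Proof.
case: n hn a b hab hmu u t hu ht => // n _ a b ab hmu u t hu ht bound.
pose L (i : 'I_n.+1) : R := b ord0 i - a ord0 i.
have L0 i : 0 < L i by rewrite subr_gt0.
have [i0 _ Lmax] := @arg_maxP _ _ 'I_n.+1 ord0 xpredT L isT.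
have V0 : 0 < volume a b.
  rewrite /volume lebesgue_rV_box => [|i]; last exact: ltW.
  by apply: prodr_gt0 => i _; exact: L0.
have pi0 : 0 < pi :> R by exact: pi_gt0.
pose k0 : R := pi / L i0.
have k00 : 0 < k0 by exact: divr_gt0.
have muE : mu 1%N = k0 ^+ 2.
  apply: (neumann_mu2 ab hmu) => i.
  by rewrite /freq ler_pM2l// lef_pV2 ?posrE//; [exact: Lmax|exact: L0|exact: L0].
(* The range includes [k0]: the angles [k * L i / 2] stay in ]0, pi/2], so the formula is still
   continuous at the limit point. *)
have sin_gt0 k i : 0 < k -> k <= k0 -> 0 < sin (k * L i / 2).
  move=> kp kk0; apply: sin_gt0_pi; rewrite divr_gt0 ?mulr_gt0//=.
  have : k * L i <= pi.
    apply: (@le_trans _ _ (k0 * L i0)); last by rewrite /k0 divfK// lt0r_neq0.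
    by apply: ler_pM => //; [exact: ltW|exact: ltW|exact: Lmax].
  by move: pi pi0 => p p0; lra.
have [le_bound eq_bound] := @limit_value_ge R n.+1 L (volume a b) (L i0) L0 V0
  (fun i => Lmax i isT) (ex_intro _ i0 erefl).
exists (boundary_limit L (volume a b) k0); split.
- have E c : 0 < c < mu 1%N ->
      c * \int[surface a b]_x t c x = boundary_limit L (volume a b) (Num.sqrt c).
    move=> cmu; have /andP[c0 c1] := cmu.
    have sc0 : 0 < Num.sqrt c by rewrite sqrtr_gt0.
    have sck : Num.sqrt c <= k0.
      by rewrite -(ger0_norm (ltW k00)) -sqrtr_sqr ler_wsqrtr// -muE ltW.
    have cE : c = Num.sqrt c ^+ 2 by rewrite sqr_sqrtr// ltW.
    have s0 i : 0 < sin (Num.sqrt c * L i / 2) by exact: sin_gt0.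
    rewrite {1}cE (boundary_integral_eq ab sc0 s0 _ (ht c cmu)); last first.
      by rewrite -cE; exact: hu.
    exact: boundary_sol.
  have G : boundary_limit L (volume a b) (Num.sqrt c) @[c --> (mu 1%N)^'-] -->
      boundary_limit L (volume a b) k0.
    (* The closed formula is continuous at [mu 1] from both sides; only its agreement with the
       boundary integral is restricted to [c < mu 1]. *)
    apply: cvg_at_left_filter; rewrite muE.
    have sq : Num.sqrt (c : R) @[c --> k0 ^+ 2] --> k0.
      have := @sqrt_continuous R (k0 ^+ 2).
      by rewrite /continuous_at sqrtr_sqr (ger0_norm (ltW k00)).
    apply: (continuous_cvg _ _ sq).
    by apply: boundary_limit_continuous => i; exact: sin_gt0.
  apply: cvg_trans G; apply: near_eq_cvg; near=> c.
  rewrite E//; apply/andP; split.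
    by near: c; apply: nbhs_left_gt; rewrite muE exprn_gt0.
  by near: c; exact: nbhs_left_lt.
- by rewrite /bound (perimeterE ab); exact: le_bound.
- rewrite /bound (perimeterE ab); exact: eq_bound.
Unshelve. all: by end_near. Qed.
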